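(* Let $G$ be an $n$-vertex connected graph containing at least one non-complete block, $n\geqslant 5$. Then $$\frac{Sz(G)}{W(G)}\geqslant 1+\frac{12}{n^3-19n+54}$$ with equality if and only if $G\cong B_n^{(1)}$.
   Context: All graphs are finite, simple, undirected. $W(G)=\sum_{\{u,v\}\subseteq V_G} d_G(u,v)$ is the Wiener index. For an edge $e=uv$, let $n_u(e)$ be the number of vertices strictly closer to $u$ than to $v$, and $n_v(e)$ the number strictly closer to $v$ than to $u$. The Szeged index is $Sz(G)=\sum_{e=uv\in E_G}n_u(e)n_v(e)$. A block is a maximal connected subgraph without a cut vertex. $K_4^-$ is $K_4$ minus one edge, and $B_n^{(1)}$ is the $n$-vertex graph obtained by identifying an end-vertex of the path $P_{n-3}$ (on $n-3$ vertices) with a degree-3 vertex of $K_4^-$. *)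

(* Defs.v *)
From mathcomp Require Import all_boot.

Set Implicit Arguments.
Unset Strict Implicit.
Unset Printing Implicit Defensive.

Record sgraph := SGraph {
  vertex :> finType;
  adj : rel vertex;
  adj_sym : symmetric adj;
  adj_irr : irreflexive adj }.

Definition connected (G : sgraph) : Prop :=
  forall x y : G, connect (@adj G) x y.

Definition isomorphic (G H : sgraph) : Prop :=
  exists f : G -> H,
    bijective f /\ forall x y : G, adj (f x) (f y) = adj x y.

Definition has_walk (G : sgraph) (x y : G) (k : nat) : bool :=
  [exists p : k.-tuple G, path (@adj G) x p && (last x p == y)].

(* Least length of a walk from x to y; the junk value #|G| is returned when y
   is not reachable from x (reachable vertices are at distance < #|G|). *)
Definition dist (G : sgraph) (x y : G) : nat :=
  find (has_walk x y) (iota 0 #|G|).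

(* Unordered pairs of distinct vertices are enumerated by the pairs that are
   increasing for enum_rank, so that each pair {x, y} is counted once; the
   summands below are symmetric in x and y. *)
Definition ltv (G : sgraph) (x y : G) : bool := enum_rank x < enum_rank y.

Definition wiener (G : sgraph) : nat :=
  \sum_(p : G * G | ltv p.1 p.2) dist p.1 p.2.

Definition ncloser (G : sgraph) (u v : G) : nat :=
  #|[set w : G | dist w u < dist w v]|.

Definition szeged (G : sgraph) : nat :=
  \sum_(p : G * G | ltv p.1 p.2 && adj p.1 p.2)
     ncloser p.1 p.2 * ncloser p.2 p.1.

Record subgraph (G : sgraph) := Subgraph {
  sv : {set G};
  se : rel G;
  se_sym : symmetric se;
  se_adj : forall x y, se x y -> adj x y;
  se_sv : forall x y, se x y -> x \in sv }.

Definition subgraph_le (G : sgraph) (H K : subgraph G) : Prop :=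
  sv H \subset sv K /\ forall x y, se H x y -> se K x y.

Definition sub_connected (G : sgraph) (H : subgraph G) : Prop :=
  sv H != set0 /\ {in sv H &, forall x y, connect (se H) x y}.

Definition del_vertex (G : sgraph) (H : subgraph G) (v : G) : rel G :=
  [rel x y | [&& x != v, y != v & se H x y]].

(* Deleting v separates two other vertices of its component in H. *)
Definition cut_vertex (G : sgraph) (H : subgraph G) (v : G) : Prop :=
  v \in sv H /\
  exists x y : G, [/\ x \in sv H :\ v, y \in sv H :\ v,
    connect (se H) x y & ~~ connect (del_vertex H v) x y].

Definition nonseparable (G : sgraph) (H : subgraph G) : Prop :=
  sub_connected H /\ forall v, ~ cut_vertex H v.

Definition block (G : sgraph) (H : subgraph G) : Prop :=
  nonseparable H /\
  forall K : subgraph G, nonseparable K -> subgraph_le H K -> subgraph_le K H.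

Definition complete (G : sgraph) (H : subgraph G) : Prop :=
  {in sv H &, forall x y, x != y -> se H x y}.

Section PathGraph.
Variable n : nat.
Definition path_adj : rel 'I_n :=
  [rel i j : 'I_n | (i.+1 == j :> nat) || (j.+1 == i :> nat)].
Lemma path_adj_sym : symmetric path_adj.
Proof. by move=> i j; exact: orbC. Qed.
Lemma path_adj_irr : irreflexive path_adj.
Proof. by move=> i; rewrite /path_adj /= orbb eqn_leq ltnn. Qed.
Definition path_graph : sgraph := SGraph path_adj_sym path_adj_irr.
End PathGraph.

(* The missing edge is {2, 3}; 0 and 1 are the vertices of degree 3. *)
Definition K4m_adj : rel 'I_4 :=
  [rel i j : 'I_4 | (i != j) && ~~ ((1 < i) && (1 < j))].
Lemma K4m_adj_sym : symmetric K4m_adj.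
Proof. by move=> i j; rewrite /K4m_adj /= eq_sym [(1 < i) && _]andbC. Qed.
Lemma K4m_adj_irr : irreflexive K4m_adj.
Proof. by move=> i; rewrite /K4m_adj /= eqxx. Qed.
Definition K4m : sgraph := SGraph K4m_adj_sym K4m_adj_irr.

(* The disjoint union of G and H with y identified to x: the merged vertex is
   represented by inl x, and y is dropped from the vertices of H. *)
Section Identify.
Variables (G H : sgraph) (x : G) (y : H).
Definition ident_adj : rel (G + {v : H | v != y})%type :=
  fun a b => match a, b with
  | inl u, inl u' => adj u u'
  | inr v, inr v' => adj (val v) (val v')
  | inl u, inr v => (u == x) && adj y (val v)
  | inr v, inl u => (u == x) && adj y (val v)
  end.
Lemma ident_adj_sym : symmetric ident_adj.
Proof. by move=> [u|v] [u'|v'] //=; exact: adj_sym. Qed.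
Lemma ident_adj_irr : irreflexive ident_adj.
Proof. by move=> [u|v] /=; exact: adj_irr. Qed.
Definition identify : sgraph := SGraph ident_adj_sym ident_adj_irr.
End Identify.

(* (n - 4).+1 is n - 3 when 4 <= n, which makes the end-vertex ord0 of the path
   available without a proof argument. *)
Definition B1 (n : nat) : sgraph :=
  @identify (path_graph (n - 4).+1) K4m ord0 ord0.

Lemma card_B1 n : 4 <= n -> #|B1 n| = n.
Proof.
move=> n4; rewrite card_sum card_ord card_sig.
by rewrite (eq_card (B := predC1 (ord0 : 'I_4))) // cardC1 card_ord addSnnS subnK.
Qed.

Lemma K4m_deg3 : #|[set v : K4m | @adj K4m ord0 v]| = 3.
Proof. by rewrite -sum1dep_card big_mkcond !big_ord_recl big_ord0. Qed.

(* Main.v *)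
Require Import Defs.
From mathcomp Require Import all_boot all_order all_algebra zify ring.

(* Write mu(x,y) for the number of edges separating x from y, that is, with one
   end strictly closer to x and the other strictly closer to y. Double counting
   gives Sz = sum of mu(x,y) over the pairs {x,y}, and mu >= d because the edges
   of a geodesic from x to y separate x from y; hence Sz - W is the total excess
   mu - d. With K = W(B_n^(1)) = (n^3 - 19n + 54)/6 the bound is 1 + 2/K, and
   since W <= C(n+1,3) < 3K/2 it is strict as soon as Sz - W >= 3.

   If geodesics are unique, a non-complete block yields an odd cycle
   z, .., a, b, .., z with d(z,a) = d(z,b) >= 2, and three pairs of its vertices
   have positive excess. Otherwise two geodesics with common ends produce excess
   3, or a pair c, d at distance 2 with two common neighbours a, b, of excess 2.
   If Sz - W < 3 then no other pair has excess, which forces ab to be an edge and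
   G - c - d to be connected. Then G - c - d contributes at most C(n-1,3) to W,
   and the distances from c (or d) to G - c - d, the value 1 occurring twice, sum
   to at most 1 + C(n-2,2). These bounds add up to K. Equality makes all the
   distance layers around c singletons, except {a,b}, so G is B_n^(1). *)

Set Implicit Arguments.
Unset Strict Implicit.
Unset Printing Implicit Defensive.

(** * Distances *)

Lemma dist_le_walk (G : sgraph) (x : G) p :
  path (@adj G) x p -> dist x (last x p) <= size p.
Proof.
move=> px; rewrite leqNgt; apply/negP => lt_p.
(* [find] never exceeds the length of the list it searches, so a walk shorter than
   [dist x (last x p)] has its length in that list. *)
have lt_pG : size p < #|G|.
  by apply: (leq_trans lt_p); rewrite -[#|G|](size_iota 0) find_size.
have := before_find 0 lt_p; rewrite nth_iota // add0n => nwalk.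
suff: has_walk x (last x p) (size p) by rewrite nwalk.
by apply/existsP; exists (in_tuple p); rewrite px eqxx.
Qed.

Lemma dist_walk (G : sgraph) (x y : G) : connected G ->
  exists p, [/\ path (@adj G) x p, last x p = y & size p = dist x y].
Proof.
move=> conG; have /connectP[p0 p0P ->] := conG x y.
case/shortenP: p0P => p px Up _.
have has_p : has (has_walk x (last x p)) (iota 0 #|G|).
  apply/hasP; exists (size p).
    by rewrite mem_iota /= add0n; have := max_card (mem (x :: p)); rewrite (card_uniqP Up).
  by apply/existsP; exists (in_tuple p); rewrite px eqxx.
have := nth_find 0 has_p; have := has_p; rewrite has_find size_iota => lt_f.
rewrite nth_iota // add0n => /existsP[q /andP[qx /eqP lq]].
by exists q; rewrite size_tuple.
Qed.

(** Descent produces walks of length at most [D x y], and the Lipschitz condition keeps every walk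
    from being shorter. Connectedness comes out along with the distances; this serves for
    isomorphisms and for the explicit distances in the kite. *)
Lemma dist_unique (G : sgraph) (D : G -> G -> nat) :
  (forall x, D x x = 0) ->
  (forall x y y', adj y y' -> D x y' <= (D x y).+1) ->
  (forall x y, x != y -> exists2 y', adj y' y & D x y' < D x y) ->
  connected G /\ forall x y : G, dist x y = D x y.
Proof.
move=> D0 DS Dpred.
have wD x k : forall y, D x y <= k ->
    exists p, [/\ path (@adj G) x p, last x p = y & size p <= k].
  elim: k => [|k IHk] y leD.
    have [<-|/Dpred[y' _]] := eqVneq x y; first by exists [::].
    by rewrite ltnNge (leq_trans leD).
  have [<-|/Dpred[y' y'y ltD]] := eqVneq x y; first by exists [::].
  have [|p [px lp sp]] := IHk y'; first by rewrite -ltnS (leq_trans ltD).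
  by exists (rcons p y); rewrite rcons_path last_rcons size_rcons px lp y'y.
have conG : connected G.
  move=> x y; have [p [px <- _]] := wD x _ y (leqnn _).
  by apply/connectP; exists p.
split=> // x y; apply/eqP; rewrite eqn_leq; apply/andP; split.
  have [p [px <- sp]] := wD x _ y (leqnn _).
  exact: leq_trans (dist_le_walk px) sp.
have [p [px <- <-]] := dist_walk x y conG.
elim/last_ind: p px => [|p v IHp]; first by rewrite D0.
rewrite rcons_path last_rcons size_rcons => /andP[/IHp le_p pv].
exact: leq_trans (DS x _ _ pv) _.
Qed.

Lemma isom_dist (G H : sgraph) (f : G -> H) : connected H -> bijective f ->
  (forall x y, adj (f x) (f y) = adj x y) ->
  connected G /\ forall x y, dist (f x) (f y) = dist x y.
Proof.
move=> conH [g fK gK] fadj.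
have [||| conG dE] := @dist_unique G (fun x y => dist (f x) (f y)).
- by move=> x; have := @dist_le_walk H (f x) [::] isT; rewrite leqn0 => /eqP.
- move=> x y y' yy'; have [p [px lp <-]] := dist_walk (f x) (f y) conH.
  have := @dist_le_walk H (f x) (rcons p (f y')).
  by rewrite rcons_path last_rcons size_rcons px lp fadj yy'; apply.
- move=> x y xNy; have [p [px lp <-]] := dist_walk (f x) (f y) conH.
  case/lastP: p px lp => [_ /(can_inj fK) xy|p v]; first by rewrite xy eqxx in xNy.
  rewrite rcons_path last_rcons size_rcons => /andP[px pv] vE.
  exists (g (last (f x) p)); first by rewrite -fadj gK -vE.
  by rewrite gK ltnS dist_le_walk.
by split=> // x y; rewrite dE.
Qed.

Section Metric.
Variables (G : sgraph) (conG : connected G).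
Implicit Types x y z u v w : G.

Lemma distxx x : dist x x = 0.
Proof. by have := @dist_le_walk G x [::] isT; rewrite leqn0 => /eqP. Qed.

Lemma dist_triangle z x y : dist x y <= dist x z + dist z y.
Proof.
have [p [px lp <-]] := dist_walk x z conG.
have [q [qz lq <-]] := dist_walk z y conG.
have := @dist_le_walk G x (p ++ q).
by rewrite cat_path last_cat size_cat px lp qz lq; apply.
Qed.

Lemma dist_adjS x y y' : adj y y' -> dist x y' <= (dist x y).+1.
Proof.
move=> yy'; apply: (leq_trans (dist_triangle y x y')); rewrite -addn1 leq_add2l.
by have := @dist_le_walk G y [:: y']; rewrite /= yy'; apply.
Qed.

Lemma dist_sym x y : dist x y = dist y x.
Proof.
suff le u v : dist u v <= dist v u by apply/eqP; rewrite eqn_leq !le.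
have [p [pv <- <-]] := dist_walk v u conG.
elim: p v pv => [|w p IHp] v /=; first by rewrite distxx.
move=> /andP[vw /IHp le_p]; have wv : adj w v by rewrite adj_sym.
exact: leq_trans (dist_adjS _ wv) _.
Qed.

Lemma dist_eq0 x y : (dist x y == 0) = (x == y).
Proof.
apply/eqP/eqP => [d0|->]; last exact: distxx.
by have [p [_ lp]] := dist_walk x y conG; move: lp; rewrite d0; case: p.
Qed.

Lemma dist_gt0 x y : (0 < dist x y) = (x != y).
Proof. by rewrite lt0n dist_eq0. Qed.

Lemma dist_adj x y : adj x y -> dist x y = 1.
Proof.
move=> xy; apply/eqP; rewrite eqn_leq dist_gt0.
have := dist_adjS x xy; rewrite distxx => ->.
by apply: contraTneq xy => ->; rewrite adj_irr.
Qed.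

Lemma dist_pred x y : x != y ->
  exists2 y', adj y' y & dist x y = (dist x y').+1.
Proof.
have [p [px lp sp]] := dist_walk x y conG.
case/lastP: p px lp sp => [_ /= ->|p v]; first by rewrite eqxx.
rewrite rcons_path last_rcons size_rcons => /andP[px pv] <- dE _.
exists (last x p) => //; apply/eqP; rewrite eqn_leq (dist_adjS x pv).
by rewrite -dE ltnS dist_le_walk.
Qed.

Lemma adj_dist1 x y : dist x y = 1 -> adj x y.
Proof.
move=> d1; have xNy : x != y by rewrite -dist_gt0 d1.
have [z zy] := dist_pred xNy; rewrite d1 => -[/esym/eqP].
by rewrite dist_eq0 => /eqP->.
Qed.

Lemma dist2 x z y : adj x z -> adj z y -> x != y -> ~~ adj x y -> dist x y = 2.
Proof.
move=> xz zy xNy nxy; apply/eqP; rewrite eqn_leq.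
have := dist_adjS x zy; rewrite (dist_adj xz) => -> /=.
have := dist_gt0 x y; rewrite xNy; case E: (dist x y) => [|[|]] // _.
by rewrite (adj_dist1 E) in nxy.
Qed.

End Metric.

(** * Separating edges and excess *)

(* [lia] case-splits on every boolean hypothesis, hence the clearing. *)
Ltac dlia :=
  repeat match goal with
  | H : is_true (adj _ _) |- _ => clear H
  | H : is_true (~~ @eq_op (fintype_Finite__to__eqtype_Equality _) _ _) |- _ => clear H
  | H : _ = false |- _ => clear H
  end; lia.

(* Separating edges, oriented from the side of [x] to the side of [y]. *)
Definition sep (G : sgraph) (x y : G) : {set G * G} :=
  [set e | [&& adj e.1 e.2, dist x e.1 < dist x e.2 & dist y e.2 < dist y e.1]].

Lemma sum_ltv (G : sgraph) (F : G -> G -> nat) :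
  (forall x y, F x y = F y x) -> (forall x, F x x = 0) ->
  \sum_x \sum_y F x y = 2 * \sum_(p : G * G | ltv p.1 p.2) F p.1 p.2.
Proof.
move=> Fsym F0; rewrite pair_bigA /= mul2n -addnn.
rewrite [X in _ = _ + X](reindex_inj (h := fun p : G * G => (p.2, p.1))) /=; last first.
  by move=> [x y] [x' y'] [-> ->].
rewrite [X in _ = X + _]big_mkcond [X in _ = _ + X]big_mkcond -big_split /=; apply: eq_bigr => -[x y] _ /=.
rewrite /ltv [F y x]Fsym; case: ltngtP => [||/val_inj/enum_rank_inj->] //=.
by rewrite addn0.
Qed.

Lemma sum_dist (G : sgraph) : connected G ->
  \sum_(x : G) \sum_(y : G) dist x y = 2 * wiener G.
Proof. by move=> conG; rewrite sum_ltv // => *; [exact: dist_sym|exact: distxx]. Qed.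

Lemma ncloserE (G : sgraph) (u v : G) :
  ncloser u v = \sum_(x : G) (dist x u < dist x v).
Proof.
by rewrite /ncloser -sum1_card big_mkcond; apply: eq_bigr => x _; rewrite inE; case: ifP.
Qed.

Lemma sum_ncloser (G : sgraph) :
  \sum_(u : G) \sum_(v : G) adj u v * (ncloser u v * ncloser v u) = 2 * szeged G.
Proof.
rewrite (sum_ltv (F := fun u v => adj u v * (ncloser u v * ncloser v u))).
- congr (2 * _); rewrite /szeged big_mkcondr /=; apply: eq_bigr => p _.
  by case: (adj _ _); rewrite ?mul1n.
- by move=> u v; rewrite adj_sym [ncloser u v * _]mulnC.
- by move=> u; rewrite adj_irr.
Qed.

(** Exchange of sums: the ordered pairs [(x, y)] with [(u, v)] in [sep x y] number
    [ncloser u v * ncloser v u]. *)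
Lemma sum_sep (G : sgraph) :
  \sum_(x : G) \sum_(y : G) #|sep x y| = 2 * szeged G.
Proof.
rewrite -sum_ncloser [RHS]pair_bigA.
transitivity (\sum_(x : G) \sum_(y : G) \sum_(e : G * G) (e \in sep x y)).
  apply: eq_bigr => x _; apply: eq_bigr => y _.
  by rewrite -sum1_card big_mkcond; apply: eq_bigr => e _; case: ifP.
rewrite pair_bigA exchange_big /=; apply: eq_bigr => -[u v] _ /=.
rewrite !ncloserE big_distrlr /= pair_bigA big_distrr /=.
by apply: eq_bigr => -[x y] _; rewrite inE /= -!mulnb.
Qed.

Section Excess.
Variables (G : sgraph) (conG : connected G).
Implicit Types x y z u v w : G.

Lemma card_sepC x y : #|sep x y| = #|sep y x|.
Proof.
have swapK : injective (fun e : G * G => (e.2, e.1)) by move=> [? ?] [? ?] [-> ->].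
rewrite -(card_imset _ swapK); congr #|pred_of_set _|; apply/setP => -[u v].
apply/imsetP/idP => [[[u' v']] | uv].
  by rewrite !inE /= => /and3P[? ? ?] [-> ->] /=; apply/and3P; rewrite adj_sym.
exists (v, u) => //; move: uv.
by rewrite !inE /= => /and3P[? ? ?]; apply/and3P; rewrite adj_sym.
Qed.

Lemma geo_sep x y u v :
  adj u v -> dist x y = dist x u + 1 + dist v y -> (u, v) \in sep x y.
Proof.
move=> uv dE; rewrite inE /= uv (dist_sym conG y v) (dist_sym conG y u) /=.
have := dist_triangle conG v x y; have := dist_triangle conG u x y; dlia.
Qed.

Lemma geo_edge x y k : k < dist x y ->
  exists u v, [/\ adj u v, dist x u = k & dist x y = dist x u + 1 + dist v y].
Proof.
move=> ltk; have [j] : {j | dist x y = k.+1 + j} by exists (dist x y - k.+1); dlia.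
elim: j => [|j IHj] in y {ltk} *; rewrite ?addn0 => dE.
  have [|u uy] := @dist_pred G conG x y; first by rewrite -dist_gt0 // dE.
  by rewrite dE => -[ku]; exists u, y; split=> //; rewrite distxx; dlia.
have [|y' y'y dE'] := @dist_pred G conG x y; first by rewrite -dist_gt0 // dE.
have [|u [v [uv du dy']]] := IHj y'; first dlia.
exists u, v; split => //.
have := dist_adjS conG v y'y; have := dist_triangle conG v x y.
have := dist_adjS conG x uv; dlia.
Qed.

(** Outside [A] the separating edges realise every starting distance below [dist x y] from [x], so
    there are at least [dist x y] of them. The lower bounds on the excess below rest on this
    count. *)
Lemma sep_bound x y (A : {set G * G}) : A \subset sep x y ->
  (forall k, k < dist x y ->
    exists e, [/\ e \in sep x y, e \notin A & dist x e.1 = k]) ->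
  dist x y + #|A| <= #|sep x y|.
Proof.
move=> sA geo; rewrite -(cardsID A (sep x y)) (setIidPr sA) addnC leq_add2l.
rewrite -[dist x y](size_iota 0) cardE -(size_map (fun e => dist x e.1)).
apply: uniq_leq_size (iota_uniq _ _) _ => k; rewrite mem_iota add0n /= => /geo[e].
case=> sep_e Ae <-; apply: (map_f (fun e : G * G => dist x e.1)).
by rewrite mem_enum inE Ae.
Qed.

Lemma dist_le_sep x y : dist x y <= #|sep x y|.
Proof.
have := @sep_bound x y set0 (sub0set _); rewrite cards0 addn0; apply=> k.
case/geo_edge=> u [v [uv du dE]]; exists (u, v); split=> //; last by rewrite inE.
exact: geo_sep.
Qed.

Lemma sep_nongeo x y u v : (u, v) \in sep x y ->
  dist x y < dist x u + 1 + dist v y -> dist x y < #|sep x y|.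
Proof.
move=> sep_uv lt; have := @sep_bound x y [set (u, v)].
rewrite sub1set cards1 addn1; apply=> // k /geo_edge[u' [v' [uv' du dE]]].
exists (u', v'); split=> //; first exact: geo_sep.
by rewrite inE; apply: contraTneq lt => -[<- <-]; rewrite -dE ltnn.
Qed.

Lemma sep_two_preds x y u u' : adj u y -> adj u' y -> u != u' ->
  dist x u < dist x y -> dist x u' < dist x y ->
  dist x y + 2 <= #|sep x y|.
Proof.
move=> uy uy' uNu' lt lt'.
have dE := dist_adjS conG x uy; have dE' := dist_adjS conG x uy'.
have xNu : x != u.
  apply: contraNneq uNu' => xu; rewrite -xu -dist_eq0 //.
  by move: lt lt' dE dE'; rewrite -xu distxx //; dlia.
have xNu' : x != u'.
  apply: contraNneq uNu' => xu; rewrite eq_sym -xu -dist_eq0 //.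
  by move: lt lt' dE dE'; rewrite -xu distxx //; dlia.
have [w wu dw] := dist_pred conG xNu; have [w' wu' dw'] := dist_pred conG xNu'.
have dyy := distxx y.
have duy := dist_adj conG uy; have duy' := dist_adj conG uy'.
(* The last two edges of a geodesic through [u'] form the surplus. A geodesic through [u] supplies
   the two top levels without them, and any geodesic supplies the lower levels. *)
have := @sep_bound x y [set (u', y); (w', u')].
rewrite cards2 xpair_eqE; case: (u' =P w') dw' => [->|_]; first by dlia.
move=> dw'; rewrite /=; apply=> [|k ltk].
  by apply/subsetP => e /set2P[]->; apply: geo_sep => //; dlia.
have [kE|kE] := eqVneq k (dist x u).
  exists (u, y); split=> //; first by apply: geo_sep => //; dlia.
  rewrite !inE !xpair_eqE (negPf uNu') /=; apply/negP => /andP[_ /eqP yu'].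
  by move: lt'; rewrite yu' ltnn.
have [kE'|kE'] := eqVneq k (dist x w).
  exists (w, u); split=> //; first by apply: geo_sep => //; dlia.
  rewrite !inE !xpair_eqE (negPf uNu') andbF orbF; apply/negP => /andP[_ /eqP uy1].
  by move: lt; rewrite uy1 ltnn.
have [v [v' [vv' dv dvE]]] := geo_edge ltk.
exists (v, v'); split=> //; first exact: geo_sep.
rewrite !inE !xpair_eqE; apply/negP => /orP[]/andP[/eqP vE _]; subst v; dlia.
Qed.

(** If the predecessors [w], [w'] of [u], [u'] coincide, they close a 4-cycle with [y]. Otherwise
    the argument of [sep_two_preds] works with three final edges; distance at least 3 provides the
    three levels. *)
Lemma sep_two_preds_far x y u u' : adj u y -> adj u' y -> u != u' ->
  dist x u < dist x y -> dist x u' < dist x y -> 2 < dist x y ->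
  (exists c, [/\ dist c y = 2, adj c u & adj c u']) \/ dist x y + 3 <= #|sep x y|.
Proof.
move=> uy uy' uNu' lt lt' gt2.
have dE := dist_adjS conG x uy; have dE' := dist_adjS conG x uy'.
have xNu : x != u by rewrite -dist_gt0 //; dlia.
have xNu' : x != u' by rewrite -dist_gt0 //; dlia.
have [w wu dw] := dist_pred conG xNu; have [w' wu' dw'] := dist_pred conG xNu'.
have xNw : x != w by rewrite -dist_gt0 //; dlia.
have xNw' : x != w' by rewrite -dist_gt0 //; dlia.
have dyy := distxx y.
have duy := dist_adj conG uy; have duy' := dist_adj conG uy'.
have dwy : dist w y = 2.
  have := dist_adjS conG w uy; rewrite (dist_adj conG wu).
  have := dist_triangle conG w x y; dlia.
have dwy' : dist w' y = 2.
  have := dist_adjS conG w' uy'; rewrite (dist_adj conG wu').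
  have := dist_triangle conG w' x y; dlia.
have [ww'|wNw'] := eqVneq w w'.
  by left; exists w; split=> //; rewrite ww'.
right.
have [t tw dt] := dist_pred conG xNw; have [t' tw' dt'] := dist_pred conG xNw'.
have := @sep_bound x y [set e in [:: (u', y); (w', u'); (t', w')]].
have neq z z' : dist x z != dist x z' -> (z == z') = false.
  by move=> d; apply/eqP => E; rewrite E eqxx in d.
have u'w' : (u' == w') = false by apply: neq; dlia.
have u't' : (u' == t') = false by apply: neq; dlia.
have w't' : (w' == t') = false by apply: neq; dlia.
rewrite cardsE; have -> : #|[:: (u', y); (w', u'); (t', w')]| = 3.
  by apply: (card_uniqP _); rewrite /= !inE !xpair_eqE u'w' u't' w't'.
apply=> [|k ltk].
  apply/subsetP => e; rewrite inE => Ae; rewrite !inE in Ae.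
  by case/or3P: Ae => /eqP->; apply: geo_sep => //; dlia.
have [kE|kE] := eqVneq k (dist x u).
  exists (u, y); split=> //; first by apply: geo_sep => //; dlia.
  by rewrite !inE !xpair_eqE (negPf uNu') /= (neq u w') ?(neq u t') //; dlia.
have [kE'|kE'] := eqVneq k (dist x w).
  exists (w, u); split=> //; first by apply: geo_sep => //; dlia.
  by rewrite !inE !xpair_eqE (negPf wNw') /= (neq w u') ?(neq w t') //; dlia.
have [kE''|kE''] := eqVneq k (dist x t).
  exists (t, w); split=> //; first by apply: geo_sep => //; dlia.
  by rewrite !inE !xpair_eqE (negPf wNw') andbF (neq t u') ?(neq t w') //; dlia.
have [v [v' [vv' dv dvE]]] := geo_edge ltk.
exists (v, v'); split=> //; first exact: geo_sep.
rewrite !inE !xpair_eqE; apply/negP => /or3P[]/andP[/eqP vE _]; subst v; dlia.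
Qed.

(** In the sums over ordered pairs each listed pair counts together with its reverse. The uniqueness
    hypothesis says that the entries are off the diagonal and distinct as unordered pairs. *)
Lemma szeged_excess (s : seq (G * G)) : uniq (s ++ [seq (p.2, p.1) | p <- s]) ->
  wiener G + \sum_(p <- s) (#|sep p.1 p.2| - dist p.1 p.2) <= szeged G.
Proof.
move=> Us; rewrite -(leq_pmul2l (isT : 0 < 2)) mulnDr -sum_sep -sum_dist //.
set F := fun p : G * G => #|sep p.1 p.2| - dist p.1 p.2.
have -> : 2 * \sum_(p <- s) F p = \sum_(p <- s ++ [seq (p.2, p.1) | p <- s]) F p.
  rewrite big_cat big_map mul2n -addnn; congr (_ + _); apply: eq_bigr => p _.
  by rewrite /F /= card_sepC dist_sym.
rewrite (big_uniq _ Us) /= !pair_bigA [X in _ + X <= _]big_mkcond -big_split.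
by apply: leq_sum => p _; have := dist_le_sep p.1 p.2; rewrite /F; case: ifP => _ /=; dlia.
Qed.

End Excess.

(** * Non-complete blocks *)

Section AddEdge.
Variables (G : sgraph) (H : subgraph G) (x y : G).
Hypotheses (xH : x \in sv H) (yH : y \in sv H) (xy : adj x y).

Definition add_edge_rel : rel G :=
  [rel u v | [|| se H u v, (u == x) && (v == y) | (u == y) && (v == x)]].

Lemma add_edge_sym : symmetric add_edge_rel.
Proof.
move=> u v; rewrite /add_edge_rel /= se_sym.
by rewrite [(u == x) && _]andbC [(u == y) && _]andbC [(_ && _) || _]orbC.
Qed.

Lemma add_edge_adj u v : add_edge_rel u v -> adj u v.
Proof.
by case/or3P => [/se_adj//|/andP[/eqP-> /eqP->]//|/andP[/eqP-> /eqP->]]; rewrite adj_sym.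
Qed.

Lemma add_edge_sv u v : add_edge_rel u v -> u \in sv H.
Proof. by case/or3P => [/se_sv//|/andP[/eqP->]//|/andP[/eqP->]]. Qed.

Definition add_edge := Subgraph add_edge_sym add_edge_adj add_edge_sv.

Lemma add_edge_nonseparable : nonseparable H -> nonseparable add_edge.
Proof.
move=> [[H0 conH] ncut]; split.
  split=> // u v uH vH; apply: connect_sub (conH u v uH vH) => a b ab.
  by apply: connect1; rewrite /= /add_edge_rel /= ab.
move=> v [vH [p [q [pH qH _ /negP[]]]]].
have [pH' qH'] : p \in sv H /\ q \in sv H by move: pH qH; rewrite !inE => /andP[_ ?] /andP[_ ?].
have [|nc] := boolP (connect (del_vertex H v) p q).
  apply: connect_sub => a b /and3P[av bv ab]; apply: connect1.
  by rewrite /del_vertex /= av bv /add_edge_rel /= ab.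
by case: (ncut v); split=> //; exists p, q; split=> //; exact: conH.
Qed.

End AddEdge.

(** An edge added between two vertices of a nonseparable subgraph creates no cut vertex, so a block,
    being maximal, already contains it. *)
Lemma block_induced (G : sgraph) (H : subgraph G) : block H ->
  {in sv H &, forall x y, adj x y -> se H x y}.
Proof.
move=> [nsH maxH] x y xH yH xy.
have [|_ sub] := maxH _ (add_edge_nonseparable xH yH xy nsH).
  by split=> // u v uv; rewrite /= /add_edge_rel /= uv.
by apply: sub; rewrite /= /add_edge_rel /= !eqxx orbT.
Qed.

Definition avoid (G : sgraph) (z : G) : rel G :=
  [rel x y | [&& x != z, y != z & adj x y]].

(** Take [x], [y] nonadjacent in the block, [z] the last neighbour of [x] on a path to [y], and [w]
    the vertex after [z]. Since [z] is no cut vertex of the block, [x] and [w] remain connected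
    without it. *)
Lemma noncomplete_block_path (G : sgraph) (H : subgraph G) :
  block H -> ~ complete H ->
  exists u z w : G, [/\ adj u z, adj z w, u != w, ~~ adj u w & connect (avoid z) u w].
Proof.
move=> blH ncH; have indH := block_induced blH; have [[[_ conH] ncut] _] := blH.
have [/forall_inP compH|] :=
    boolP [forall x in sv H, [forall y in sv H, (x != y) ==> se H x y]].
  by case: ncH => x y /compH/forall_inP yH /yH/implyP.
rewrite negb_forall_in => /exists_inP[x xH].
rewrite negb_forall_in => /exists_inP[y yH]; rewrite negb_imply => /andP[xNy xy].
have [p px lp] := connectP (conH x y xH yH).
have {}xy : ~~ adj x y by apply: contra xy; exact: indH.
suff [z [w [xz zw wH xNw xw]]] : exists z w,
    [/\ adj x z, se H z w, w \in sv H, x != w & ~~ adj x w].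
  exists x, z, w; split; rewrite // ?(se_adj zw) //.
  have zx : z != x by apply: contraTneq xz => ->; rewrite adj_irr.
  have zw' : z != w by apply: contraTneq (se_adj zw) => ->; rewrite adj_irr.
  have [|nc] := boolP (connect (del_vertex H z) x w).
    by apply: connect_sub => a b /and3P[az bz /se_adj ab]; apply: connect1; rewrite /avoid /= az bz.
  case: (ncut z); split; first exact: se_sv zw.
  exists x, w; split=> //; last exact: conH.
    by rewrite !inE eq_sym zx.
  by rewrite !inE eq_sym zw'.
elim/last_ind: p y px lp xNy xy yH => [|p w IHp] y; first by move=> _ ->; rewrite eqxx.
rewrite rcons_path last_rcons => /andP[px pw] -> xNw xw wH.
have zH := se_sv pw; have [zx|xNz] := eqVneq x (last x p).
  by move: (se_adj pw); rewrite -zx (negPf xw).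
have [xz|xz] := boolP (adj x (last x p)); last exact: IHp px _ xNz xz zH.
by exists (last x p), w; split.
Qed.

(** * Graphs with unique geodesics *)

Definition geodetic (G : sgraph) : Prop := forall x y u u' : G,
  adj u y -> adj u' y -> dist x u < dist x y -> dist x u' < dist x y -> u = u'.

Section Geodetic.
Variables (G : sgraph) (conG : connected G) (geoG : geodetic G).
Implicit Types a b u v w z : G.

(* [v] is the second vertex of the geodesic from [z] to [x]. *)
Definition branch z x v := adj v z && (dist x v < dist x z).

Lemma branch_uniq z x v v' : branch z x v -> branch z x v' -> v = v'.
Proof. by move=> /andP[vz lt] /andP[vz' lt']; exact: geoG lt lt'. Qed.

Lemma branch_exists z x : x != z -> exists v, branch z x v.
Proof.
by move/(dist_pred conG)=> [v vz dE]; exists v; rewrite /branch vz dE /=.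
Qed.

(* The cycle through [z], [va], [a], [b], [vb] has odd length [2k+1 >= 5]; an
   edge of it and the two cycle vertices half-way around form a pair whose
   geodesic misses the edge. *)
Lemma far_edge_excess z a b va vb : adj a b ->
  branch z a va -> branch z b vb -> va != vb ->
  dist a z = dist b z -> 1 < dist a z -> wiener G + 3 <= szeged G.
Proof.
move=> ab Ba Bb vNv eqd gt1.
have [vaz ltva] := andP Ba; have [vbz ltvb] := andP Bb.
have dva := dist_adjS conG a vaz; have dvb := dist_adjS conG b vbz.
have zv : adj z va by rewrite adj_sym.
have zv' : adj z vb by rewrite adj_sym.
have ba : adj b a by rewrite adj_sym.
have dab := dist_adj conG ab; have dba := dist_adj conG ba.
have ndva : dist b z <= dist b va.
  rewrite leqNgt; apply/negP => lt; case/eqP: vNv; apply: (@branch_uniq z b) => //.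
  by rewrite /branch vaz.
have ndvb : dist a z <= dist a vb.
  rewrite leqNgt; apply/negP => lt; case/eqP: vNv; apply: (@branch_uniq z a) => //.
  by rewrite /branch vbz.
have tva := dist_triangle conG a b va; have tvb := dist_triangle conG b a vb.
have [|a' a'a dza] := @dist_pred G conG z a.
  by apply: contraTneq gt1 => <-; rewrite distxx.
have [|b' b'b dzb] := @dist_pred G conG z b.
  by apply: contraTneq gt1 => zb; rewrite eqd -zb distxx.
rewrite !(dist_sym conG z) in dza dzb.
(* Otherwise [x] and [y'] would both be predecessors of [y] as seen from [v], hence equal, although
   only [y'] is closer to [z] than [y]. *)
have far v x y y' : dist x v < dist y v -> dist y z <= dist y v -> dist x z = dist y z ->
    adj x y -> adj y' y -> dist y z = (dist y' z).+1 -> dist y' z < dist y' v.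
  move=> lt yzv xyz xy y'y dy; rewrite ltnNge; apply/negP => le.
  have xy' : x = y'.
    by apply: (@geoG v y) => //; rewrite !(dist_sym conG v) //; dlia.
  by move: xyz; rewrite xy'; dlia.
have farb : dist b' z < dist b' va by apply: (far va a b b') => //; dlia.
have fara : dist a' z < dist a' vb by apply: (far vb b a a') => //; dlia.
have e1 : dist a b' < #|sep a b'|.
  have := dist_triangle conG b a b'; rewrite (dist_sym conG b b') (dist_adj conG b'b) dab => t.
  apply: (@sep_nongeo _ conG _ _ va z); first by rewrite inE /= vaz ltva.
  by rewrite (dist_sym conG z); dlia.
have e2 : dist b a' < #|sep b a'|.
  have := dist_triangle conG a b a'; rewrite (dist_sym conG a a') (dist_adj conG a'a) dba => t.
  apply: (@sep_nongeo _ conG _ _ vb z); first by rewrite inE /= vbz ltvb.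
  by rewrite (dist_sym conG z); dlia.
have e3 : dist va vb < #|sep va vb|.
  have := dist_triangle conG z va vb; rewrite (dist_adj conG vaz) (dist_adj conG zv') => t.
  apply: (@sep_nongeo _ conG _ _ a b).
    by rewrite inE /= ab !(dist_sym conG va) !(dist_sym conG vb); dlia.
  by rewrite (dist_sym conG va a); dlia.
have neq x y : dist x z != dist y z -> (x == y) = false.
  by move=> d; apply/eqP => E; rewrite E eqxx in d.
have dva1 := dist_adj conG vaz; have dvb1 := dist_adj conG vbz.
have [aa' [ab' [ba' [bb' [av bv]]]]] : a == a' = false /\ a == b' = false /\
    b == a' = false /\ b == b' = false /\ a == va = false /\ b == va = false.
  by do ![split]; apply: neq; dlia.
have [av' bv'] : a == vb = false /\ b == vb = false.
  by do ![split]; apply: neq; dlia.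
have aNb : a == b = false by apply/eqP => E; rewrite E adj_irr in ab.
have Us : uniq ([:: (a, b'); (b, a'); (va, vb)] ++ [:: (b', a); (a', b); (vb, va)]).
  rewrite /= !inE !xpair_eqE [vb == a]eq_sym [vb == b]eq_sym.
  by rewrite aNb aa' ab' ba' bb' av av' bv bv' (negPf vNv) /= !andbF.
have := szeged_excess conG Us; rewrite !big_cons big_nil /=.
by move: #|sep a b'| e1 #|sep b a'| e2 #|sep va vb| e3 => s1 e1 s2 e2 s3 e3; dlia.
Qed.

(** Along a walk from [u] to [w] avoiding [z], the branch at [z] starts as [u] and stays equal or
    adjacent to [u] as long as the excess is below 3. It changes only between vertices equidistant
    from [z]; by [far_edge_excess] these are neighbours of [z], hence their own branches. But the
    branch of [w] is [w], neither equal nor adjacent to [u]. *)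
Lemma geodetic_excess u z w : adj u z -> adj z w -> u != w -> ~~ adj u w ->
  connect (avoid z) u w -> wiener G + 3 <= szeged G.
Proof.
move=> uz zw uNw uw con_uw; rewrite leqNgt; apply/negP => small.
have wz : adj w z by rewrite adj_sym.
have self v : adj v z -> branch z v v.
  by move=> vz; rewrite /branch vz distxx dist_gt0 //; apply: contraTneq vz => ->; rewrite adj_irr.
suff [v Bv] : exists2 v, branch z w v & (v == u) || adj v u.
  by rewrite (branch_uniq Bv (self w wz)) eq_sym (negPf uNw) adj_sym (negPf uw).
have [p pu ->] := connectP con_uw; elim/last_ind: p pu => [_|p b IHp] /=.
  by exists u; rewrite ?eqxx ?self.
rewrite rcons_path last_rcons => /andP[/IHp[v Bv vu] /and3P[az bz ab]].
move: (last u p) Bv az ab => a Bv az ab {IHp}.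
have [v' Bv'] := branch_exists bz.
have [vv'|vNv'] := eqVneq v v'; first by exists v => //; rewrite vv'.
have dva := dist_adjS conG a (andP Bv').1.
have eqd : dist a z = dist b z.
  case/andP: (Bv) (Bv') => vz ltv /andP[v'z ltv'].
  have := dist_triangle conG a b v; have := dist_triangle conG b a v'.
  have ba : adj b a by rewrite adj_sym.
  rewrite (dist_adj conG ab) (dist_adj conG ba) => t t'.
  case: (ltngtP (dist a z) (dist b z)) => // lt; case/eqP: vNv'.
    by apply: (@branch_uniq z b); rewrite // /branch vz; dlia.
  by apply: (branch_uniq Bv); rewrite /branch v'z; dlia.
have da : dist a z = 1.
  apply/eqP; rewrite eqn_leq dist_gt0 // az andbT leqNgt; apply/negP => gt1.
  by have := far_edge_excess ab Bv Bv' vNv' eqd gt1; rewrite leqNgt small.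
have av : a = v.
  by apply/eqP; rewrite -dist_eq0 // -leqn0 -ltnS -da; case/andP: Bv.
have bv : b = v'.
  by apply/eqP; rewrite -dist_eq0 // -leqn0 -ltnS -da eqd; case/andP: Bv'.
subst a b; exists v' => //.
have [v'u//|v'Nu] := eqVneq v' u; apply/orP; right.
have [vu'|uNv] := eqVneq v u; first by rewrite -vu' adj_sym.
have{vu} vu : adj v u by move: vu; rewrite (negPf uNv).
have [//|v'u] := boolP (adj v' u).
case/andP: Bv => vz _; case/andP: Bv' => v'z _.
have uv : adj u v by rewrite adj_sym.
have d2 : dist u v' = 2 by rewrite (dist2 conG uv ab) // 1?eq_sym // adj_sym.
have zv' : adj z v' by rewrite adj_sym.
(* If [v'] were not adjacent to [u], then [z] and [v] would be two predecessors of [v'] as seen from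
   [u]. *)
have := geoG zv' ab; move/(_ u); rewrite d2 (dist_adj conG uz) (dist_adj conG uv).
by move=> /(_ isT isT) zv; rewrite zv adj_irr in vz.
Qed.

End Geodetic.

(** Two geodesics with different last edges fall under [sep_two_preds_far] when their ends are more
    than 2 apart, and otherwise form the 4-cycle themselves. If there are none, the graph is
    geodetic. *)
Lemma noncomplete_block_dichotomy (G : sgraph) (H : subgraph G) :
  connected G -> block H -> ~ complete H ->
  wiener G + 3 <= szeged G \/
  exists c d a b : G, [/\ a != b, dist c d = 2, adj c a /\ adj a d & adj c b /\ adj b d].
Proof.
move=> conG blH ncH.
have [/existsP[x /existsP[y /existsP[u /existsP[u']]]] | nex] :=
  boolP [exists x : G, [exists y : G, [exists u : G, [exists u' : G,
    [&& adj u y, adj u' y, u != u', dist x u < dist x y & dist x u' < dist x y]]]]].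
- case/and5P=> uy uy' uNu' lt lt'.
  have := dist_adjS conG x uy; have := dist_adjS conG x uy' => dS dS'.
  have [gt2|le2] := ltnP 2 (dist x y).
    have [[c [d2 cu cu']]|exc] := sep_two_preds_far conG uy uy' uNu' lt lt' gt2.
      by right; exists c, y, u, u'.
    left; have := @szeged_excess G conG [:: (x, y)]; rewrite big_seq1 /=.
    rewrite inE xpair_eqE negb_and -dist_gt0 // (ltnW (ltnW gt2)) => /(_ isT).
    by move: #|sep x y| exc => s exc; dlia.
  have gt0 v : adj v y -> v != x -> 1 < dist x y -> dist x y <= 2 -> dist x v < dist x y -> adj x v.
    move=> vy vNx gt1 {}le2 ltv; apply: (adj_dist1 conG).
    by have := dist_gt0 conG x v; rewrite eq_sym vNx; dlia.
  have ux : 1 < dist x y.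
    rewrite ltnNge; apply/negP => le1; case/eqP: uNu'.
    have zero v : dist x v < dist x y -> v = x.
      by move=> ltv; apply/eqP; rewrite eq_sym -dist_eq0 //; dlia.
    by rewrite (zero u) // (zero u').
  have neq v : adj v y -> v != x.
    move=> vy; apply: contraTneq ux => <-; rewrite (dist_adj conG vy) //.
  right; exists x, y, u, u'; split=> //; first by dlia.
    by split=> //; apply: gt0 => //; exact: neq.
  by split=> //; apply: gt0 => //; exact: neq.
- left; have [u [z [w [uz zw uNw uw con]]]] := noncomplete_block_path blH ncH.
  apply: (geodetic_excess conG _ uz zw uNw uw con) => x y v v' vy vy' lt lt'.
  apply/eqP; apply: contraNT nex => vNv'.
  apply/existsP; exists x; apply/existsP; exists y; apply/existsP; exists v.
  by apply/existsP; exists v'; rewrite vy vy' vNv' lt lt'.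
Qed.

(** * Bounds on sums of distances *)

(* Connectedness of the subgraph induced by [S], phrased by cuts. *)
Definition linked (G : sgraph) (S : {set G}) : Prop :=
  forall T : {set G}, T \subset S -> T != set0 -> T != S ->
  exists x y, [/\ x \in T, y \in S, y \notin T & adj x y].

Lemma linked1 (G : sgraph) (v : G) : linked [set v].
Proof. by move=> T; rewrite subset1 => /orP[]/eqP->; rewrite eqxx. Qed.

Lemma linkedU1 (G : sgraph) (S : {set G}) x y :
  linked S -> x \in S -> adj x y -> linked (y |: S).
Proof.
move=> lS xS xy T sT T0 TnS; have [yT|yT] := boolP (y \in T).
  have [TS0|TS0] := eqVneq (T :&: S) set0.
    exists y, x; split; rewrite // ?inE ?xS ?orbT // 1?adj_sym //.
    by apply: contra_eqN TS0 => xT; apply/set0Pn; exists x; rewrite inE xT.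
  have [TS|TS] := eqVneq (T :&: S) S.
    by case/eqP: TnS; apply/eqP; rewrite eqEsubset sT subUset sub1set yT -TS subsetIl.
  have [u [v [/setIP[uT uS] vS vT uv]]] := lS _ (subsetIr T S) TS0 TS.
  by exists u, v; rewrite !inE vS orbT; split=> //; apply: contra vT => vT; rewrite inE vT.
have sTS : T \subset S.
  apply/subsetP => z zT; have := subsetP sT z zT; rewrite !inE => /orP[/eqP zy|//].
  by rewrite -zy zT in yT.
have [TS|TS] := eqVneq T S; first by exists x, y; rewrite -{1}TS in xS; split; rewrite // !inE eqxx.
have [u [v [uT vS vT uv]]] := lS _ sTS T0 TS.
by exists u, v; rewrite !inE vS orbT.
Qed.

Lemma sum_rev n : \sum_(k < n) (n - k.+1) = 'C(n, 2).
Proof. by rewrite -bin2_sum big_mkord [RHS](reindex_inj rev_ord_inj). Qed.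

Section Linked.
Variables (G : sgraph) (conG : connected G).
Implicit Types (S T : {set G}) (x y z u v : G).

(** On the side of the cut that misses [a], a vertex nearest to [a] has its predecessor on the other
    side. *)
Lemma linked_pred S a : a \in S ->
  (forall x, x \in S -> x != a -> exists y, [/\ y \in S, adj y x & dist a y < dist a x]) ->
  linked S.
Proof.
move=> aS pred T sT T0 TnS.
have [aT|aT] := boolP (a \in T).
  have : exists x, x \in S :\: T.
    by apply/set0Pn; rewrite setD_eq0; apply: contra TnS => sST; rewrite eqEsubset sT.
  case=> x0 x0P; case: (arg_minnP (dist a) x0P) => x /setDP[xS xT] minx.
  have [|y [yS yx lt]] := pred x xS; first by apply: contraNneq xT => ->.
  exists y, x; split=> //; apply: contraTT lt => yT.
  by rewrite -leqNgt; apply: minx; apply/setDP.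
have [x0 x0P] := set0Pn _ T0; case: (arg_minnP (dist a) x0P) => x xT minx.
have [|y [yS yx lt]] := pred x (subsetP sT x xT); first by apply: contraTneq xT => ->.
exists x, y; split=> //; last by rewrite adj_sym.
by apply: contraTN lt => yT; rewrite -leqNgt minx.
Qed.

(** The distance is that of [G], not of the subgraph induced by [S]. Balls in a linked [S] still
    grow at each radius until they fill it, since an edge changes the distance by at most 1. *)
Definition cball S v k : {set G} := [set y in S | dist v y <= k].

Lemma cball_lt S v k : linked S -> v \in S -> cball S v k != S ->
  #|cball S v k| < #|cball S v k.+1|.
Proof.
move=> lS vS nS; have sB : cball S v k \subset S by apply/subsetP => y /[!inE]/andP[].
have [|x [y [xB yS yB xy]]] := lS _ sB _ nS.
  by apply/set0Pn; exists v; rewrite inE vS distxx.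
apply/proper_card/properP; split.
  by apply/subsetP => z; rewrite !inE => /andP[->] /leqW.
exists y => //; move: xB; rewrite !inE yS => /andP[_ le].
exact: leq_trans (dist_adjS conG v xy) _.
Qed.

Lemma cball_grow S v k j r : linked S -> v \in S -> j <= k ->
  minn r #|S| <= #|cball S v j| -> minn (r + (k - j)) #|S| <= #|cball S v k|.
Proof.
move=> lS vS /subnKC <-; rewrite addKn; elim: (k - j) => [|i IHi] base; first by rewrite !addn0.
have le_r := IHi base; have [eS|nS] := eqVneq (cball S v (j + i)) S.
  apply: leq_trans (geq_minr _ _) _; rewrite -{1}eS; apply: subset_leq_card.
  by apply/subsetP => z; rewrite !inE addnS => /andP[->] /leqW.
have := cball_lt lS vS nS; move: #|cball S v (j + i)| le_r => c le_r lt.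
by rewrite !addnS; apply: leq_trans lt; move: le_r; move: #|S| => s; lia.
Qed.

Lemma card_cball_ge S v k : linked S -> v \in S -> minn k.+1 #|S| <= #|cball S v k|.
Proof.
move=> lS vS; have := @cball_grow S v k 0 1 lS vS (leq0n k).
rewrite subn0 add1n; apply; apply: leq_trans (geq_minl _ _) _.
by rewrite card_gt0; apply/set0Pn; exists v; rewrite inE vS distxx.
Qed.

(** Layer-cake formula: [dist v y] is the number of [k] with [k < dist v y]. The radii below [#|S|]
    suffice, because the ball of radius [#|S|] is all of [S]. *)
Lemma sum_cball S v : linked S -> v \in S ->
  \sum_(y in S) dist v y = \sum_(k < #|S|) (#|S| - #|cball S v k|).
Proof.
move=> lS vS.
have bnd y : y \in S -> dist v y <= #|S|.
  have /eqP eS : cball S v #|S| == S.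
    rewrite eqEcard; apply/andP; split; first by apply/subsetP => z /[!inE]/andP[].
    by have := card_cball_ge #|S| lS vS; rewrite (minn_idPr (leqnSn _)).
  by rewrite -{1}eS inE => /andP[].
transitivity (\sum_(y in S) \sum_(k < #|S|) (k < dist v y)).
  apply: eq_bigr => y /bnd le; rewrite -(big_mkord xpredT (fun k => (k < dist v y) : nat)).
  rewrite (big_cat_nat _ (n := dist v y)) //= big_nat_cond.
  rewrite (eq_bigr (fun=> 1)) => [|k /andP[/andP[_ ->]]//].
  rewrite -big_nat_cond sum_nat_const_nat subn0 muln1 big_nat_cond big1 ?addn0 //.
  by move=> k /andP[/andP[le_k _] _]; rewrite ltnNge le_k.
rewrite exchange_big; apply: eq_bigr => k _ /=.
have sB : cball S v k \subset S by apply/subsetP => y /[!inE]/andP[].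
have -> : #|S| - #|cball S v k| = #|S :\: cball S v k| by rewrite cardsD (setIidPr sB).
rewrite -[RHS]sum1_card big_mkcond [RHS]big_mkcond /=; apply: eq_bigr => y _.
by rewrite !inE ltnNge; case: (y \in S); case: (_ <= _).
Qed.

Lemma transmission_le S v : linked S -> v \in S ->
  \sum_(y in S) dist v y <= 'C(#|S|, 2).
Proof.
move=> lS vS; rewrite sum_cball // -sum_rev; apply: leq_sum => k _.
move: (card_cball_ge k lS vS) (ltn_ord k); move: (nat_of_ord k) => i.
by move: #|cball _ _ _| #|S| => c s; lia.
Qed.

(* The second term of the left-hand side is nonzero when some distance layer
   around [v] other than the first is not a singleton, or the first is not
   [{a, b}]; it vanishes in the equality case. *)
Lemma transmission_le2 S v a b t k0 : linked S -> v \in S -> a \in S -> b \in S ->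
  adj v a -> adj v b -> a != b -> #|S| = t.+2 -> 0 < k0 <= t ->
  \sum_(y in S) dist v y + (#|cball S v k0| - k0.+2) <= t.+1 + 'C(t, 2).
Proof.
move=> lS vS aS bS va vb aNb cS /andP[k0_gt0 le_k0].
have vNa : v != a by apply: contraTneq va => ->; rewrite adj_irr.
have vNb : v != b by apply: contraTneq vb => ->; rewrite adj_irr.
(* The ball of radius 1 contains [v], [a] and [b], so all later balls are one vertex ahead of
   [card_cball_ge]. *)
have geB k : 0 < k -> minn k.+2 #|S| <= #|cball S v k|.
  move=> k_gt0; have := @cball_grow S v k 1 3 lS vS k_gt0.
  have -> : 3 + (k - 1) = k.+2 by lia.
  apply; apply: leq_trans (geq_minl _ _) _.
  have <- : #|[set v; a; b]| = 3.
    by rewrite setUC cardsU1 !inE !negb_or eq_sym vNb eq_sym aNb cards2 vNa.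
  apply: subset_leq_card; apply/subsetP => y; rewrite !inE.
  by case/orP=> [/orP[]|] /eqP->; rewrite ?vS ?aS ?bS ?distxx ?(dist_adj conG va) ?(dist_adj conG vb).
(* The surplus is charged to the summand of index [k0], where it restores the value [t - k0]. Index
   0 gives at most [t.+1], an index [k] from 1 to [t] at most [t - k], and index [t.+1] gives 0. *)
pose ex k := (k == k0) * (#|cball S v k0| - k0.+2).
have exE : #|cball S v k0| - k0.+2 = \sum_(k < #|S|) ex k.
  have ltk0 : k0 < #|S| by rewrite cS; lia.
  rewrite (bigD1 (Ordinal ltk0)) //= big1 ?addn0 => [|k]; first by rewrite /ex eqxx mul1n.
  by rewrite -val_eqE /= /ex => /negPf->.
have ex0 : ex 0 = 0 by rewrite /ex eq_sym (gtn_eqF k0_gt0).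
have exS : ex t.+1 = 0 by rewrite /ex gtn_eqF.
have leB k : #|cball S v k| <= t.+2.
  by rewrite -cS; apply/subset_leq_card/subsetP => y /[!inE]/andP[].
rewrite sum_cball // exE -big_split /= cS big_ord_recl /= ex0 addn0 -sum_rev.
apply: leq_add.
  by have := card_cball_ge 0 lS vS; rewrite cS; move: #|cball _ _ _| => x; lia.
rewrite big_ord_recr /= /bump /= add1n exS.
have -> : t.+2 - #|cball S v t.+1| = 0.
  by have := geB t.+1 isT; rewrite cS; move: #|cball _ _ _| => x; lia.
rewrite !addn0; apply: leq_sum => k _; rewrite add1n.
have := geB k.+1 isT; rewrite cS /ex; have := leB k.+1; have := ltn_ord k.
case: eqP => [<-|_]; move: (nat_of_ord k) => i;
  by move: #|cball _ _ _| => x; lia.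
Qed.

Definition dsum S := \sum_(x in S) \sum_(y in S) dist x y.

Lemma dsumU1 S v : v \notin S -> dsum (v |: S) = dsum S + 2 * \sum_(y in S) dist v y.
Proof.
move=> vS; rewrite /dsum big_setU1 //= big_setU1 //= distxx add0n.
rewrite addnC mul2n -addnn addnA; congr (_ + _).
transitivity (\sum_(x in S) (dist x v + \sum_(y in S) dist x y)).
  by apply: eq_bigr => x _; rewrite big_setU1.
by rewrite big_split addnC; congr (_ + _); apply: eq_bigr => x _; rewrite dist_sym.
Qed.

(** [S] is built from one vertex by adding neighbours, so every intermediate set is linked. The
    distances from each new vertex are bounded by [transmission_le], and Pascal's rule adds up the
    bounds. *)
Lemma dsum_le S : linked S -> dsum S <= 2 * 'C(#|S|.+1, 3).
Proof.
move=> lS; have [->|[r rS]] := set_0Vmem S; first by rewrite /dsum big_set0.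
suff grow k : k < #|S| -> exists T : {set G},
    [/\ T \subset S, #|T| = k.+1, linked T & dsum T <= 2 * 'C(k.+2, 3)].
  have S_gt0 : 0 < #|S| by rewrite card_gt0; apply/set0Pn; exists r.
  have [|T [sTS cT _]] := grow #|S|.-1; first by rewrite prednK.
  rewrite prednK // in cT *; suff -> : T = S by [].
  by apply/eqP; rewrite eqEcard sTS cT leqnn.
elim: k => [|k IHk] ltk.
  exists [set r]; rewrite sub1set cards1 rS /dsum !big_set1 distxx; split=> //.
  exact: linked1.
have [T [sTS cT lT le]] := IHk (ltnW ltk).
have [||x [y [xT yS yT xy]]] := lS T sTS.
- by rewrite -card_gt0 cT.
- by apply: contraTneq ltk => <-; rewrite cT ltnn.
have lyT := linkedU1 lT xT xy.
exists (y |: T); split=> //.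
- by rewrite subUset sub1set yS.
- by rewrite cardsU1 yT cT.
have := transmission_le lyT (setU11 y T).
rewrite big_setU1 //= distxx cardsU1 yT cT add0n dsumU1 // [X in _ <= 2 * X]binS mulnDr => le2.
by rewrite leq_add // leq_mul2l le2.
Qed.

Lemma linkedT : linked [set: G].
Proof.
move=> T _ T0 TnT; have [r rT] := set0Pn _ T0.
apply: (@linked_pred _ r) T0 TnT => // x _ xr; rewrite eq_sym in xr.
by have [y yx ->] := dist_pred conG xr; exists y; rewrite inE.
Qed.

Lemma dsumT : dsum [set: G] = 2 * wiener G.
Proof.
rewrite -sum_dist // /dsum; apply: eq_big => [x|x _]; first by rewrite inE.
by apply: eq_bigl => y; rewrite inE.
Qed.

Lemma wiener_le : wiener G <= 'C(#|G|.+1, 3).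
Proof. by have := dsum_le linkedT; rewrite dsumT cardsT leq_mul2l. Qed.

End Linked.

(** * Graphs of small excess *)

(** [c] and [d] are the tips of a $K_4^-$ whose central edge [ab] is obtained in [diamond_chord]
    from the smallness of the excess. *)
Definition diamond (G : sgraph) (c d a b : G) : Prop :=
  [/\ a != b, dist c d = 2, adj c a /\ adj a d & adj c b /\ adj b d].

Section Diamond.
Variables (G : sgraph) (conG : connected G) (small : szeged G < wiener G + 3).
Implicit Types (c d a b x y z : G) (k : nat).

Lemma diamond_swap_ends c d a b : diamond c d a b -> diamond d c a b.
Proof.
by case=> aNb d2 [ca ad] [cb bd]; split; rewrite // 1?dist_sym // ![adj d _]adj_sym ![adj _ c]adj_sym.
Qed.

Lemma diamond_swap_mid c d a b : diamond c d a b -> diamond c d b a.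
Proof. by case=> aNb d2 ca cb; split; rewrite // eq_sym. Qed.

Lemma diamond_excess c d a b : diamond c d a b -> dist c d + 2 <= #|sep c d|.
Proof.
case=> aNb d2 [ca ad] [cb bd]; apply: (sep_two_preds conG ad bd aNb).
  by rewrite d2 (dist_adj conG ca).
by rewrite d2 (dist_adj conG cb).
Qed.

Lemma diamond_szeged c d a b : diamond c d a b -> wiener G + 2 <= szeged G.
Proof.
move=> D; have := diamond_excess D; case: D => _ d2 _ _.
have cNd : c != d by rewrite -dist_gt0 // d2.
have := @szeged_excess G conG [:: (c, d)]; rewrite big_seq1 /= inE xpair_eqE (negPf cNd) /=.
by move=> /(_ isT); move: #|sep c d| => s; clear small; dlia.
Qed.

(** The pair [{c, d}] already has excess 2, so a second pair would bring the total to 3. *)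
Lemma diamond_only_excess c d a b x y : diamond c d a b -> x != y ->
  (x, y) != (c, d) -> (x, y) != (d, c) -> #|sep x y| <= dist x y.
Proof.
move=> D xNy ncd ndc; have := diamond_excess D; case: D => _ d2 _ _.
have cNd : c != d by rewrite -dist_gt0 // d2.
move=> exc; rewrite leqNgt; apply/negP => exc'; move: small; rewrite ltnNge => /negP[].
have Us : uniq ([:: (c, d); (x, y)] ++ [:: (d, c); (y, x)]).
  move: ncd ndc; rewrite /= !inE !xpair_eqE ![c == _]eq_sym ![d == _]eq_sym.
  rewrite ?(negPf cNd) ?(negPf xNy) ?[d == c]eq_sym ?(negPf cNd).
  by case: (x == c) (x == d) (y == c) (y == d) => [] [] [] [].
have := szeged_excess conG Us; rewrite !big_cons big_nil /=.
by move: #|sep c d| exc #|sep x y| exc' => s exc s' exc'; dlia.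
Qed.

(** If [a] and [b] were not adjacent, they would be at distance 2 with the common neighbours [c] and
    [d], and so have positive excess themselves. *)
Lemma diamond_chord c d a b : diamond c d a b -> adj a b.
Proof.
move=> D; case: (D) => aNb d2 [ca ad] [cb bd].
have [//|nab] := boolP (adj a b); have ac : adj a c by rewrite adj_sym.
have cNd : c != d by rewrite -dist_gt0 // d2.
have d2' : dist a b = 2 := dist2 conG ac cb aNb nab.
have db : adj d b by rewrite adj_sym.
have cNa : a != c by apply: contraTneq ca => ->; rewrite adj_irr.
have dNa : a != d by apply: contraTneq ad => ->; rewrite adj_irr.
have := sep_two_preds conG cb db cNd; move/(_ a); rewrite d2'.
rewrite (dist_adj conG ac) (dist_adj conG ad) => /(_ isT isT).
have := diamond_only_excess D aNb; rewrite !xpair_eqE (negPf cNa) (negPf dNa) d2' => /(_ isT isT).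
by move=> le /leq_trans/(_ le).
Qed.

(* Otherwise [ca] and [cb] both separate [x] from [d], and [d(x,d)] is too
   small for the two of them to lie on a common geodesic. *)
Lemma diamond_closer c d a b x : diamond c d a b -> x != c -> dist x a <= dist x c.
Proof.
move=> D xNc; case: (D) => aNb d2 [ca ad] [cb bd].
rewrite leqNgt; apply/negP => lt.
have xNd : x != d.
  by apply: contraTneq lt => ->; rewrite !(dist_sym conG d) d2 (dist_adj conG ad).
have := diamond_only_excess D xNd; rewrite !xpair_eqE (negPf xNc) (negPf xNd) => /(_ isT isT) le.
have sep_ca : (c, a) \in sep x d.
  by rewrite inE /= ca lt !(dist_sym conG d) d2 (dist_adj conG ad).
have ac : adj a c by rewrite adj_sym.
have := dist_adjS conG x ca; have := dist_adjS conG x cb => cS aS.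
have dS : dist x d <= (dist x b).+1 := dist_adjS conG x bd.
have far : dist x c + 2 <= dist x d.
  rewrite leqNgt; apply/negP => close; move: le; rewrite leqNgt => /negP[].
  by apply: (sep_nongeo conG sep_ca); rewrite (dist_adj conG ad); dlia.
have dS' := dist_adjS conG x ad.
have := sep_two_preds conG ad bd aNb; move/(_ x).
have lta : dist x a < dist x d by dlia.
have ltb : dist x b < dist x d by dlia.
by move=> /(_ lta ltb) /leq_trans/(_ le); rewrite leqNgt addnC ltnS leqnSn.
Qed.

(** A geodesic from [a] never passes through [c] or [d] on its way to another vertex: if [c]
    preceded [x], then [x] would be at distance 1 from [c] and 2 from [a], against
    [diamond_closer]. *)
Lemma diamond_linked c d a b : diamond c d a b -> linked (~: [set c; d]).
Proof.
move=> D; case: (D) => aNb d2 [ca ad] [cb bd].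
have aNc : a != c by apply: contraTneq ca => ->; rewrite adj_irr.
have aNd : a != d by apply: contraTneq ad => ->; rewrite adj_irr.
apply: (@linked_pred _ _ a) => [|x]; first by rewrite !inE negb_or aNc.
rewrite !inE negb_or => /andP[xNc xNd] xNa; rewrite eq_sym in xNa.
have [y yx dy] := dist_pred conG xNa; exists y; split; rewrite ?dy //.
have := diamond_closer D xNc; have := diamond_closer (diamond_swap_ends D) xNd.
rewrite !inE !(dist_sym conG x a) dy => led lec.
apply/negP => /orP[]/eqP E; subst y.
  by move: lec; rewrite (dist_sym conG a c) (dist_sym conG x c) (dist_adj conG yx) (dist_adj conG ca).
by move: led; rewrite (dist_sym conG x d) (dist_adj conG yx) (dist_adj conG ad).
Qed.

Lemma diamond_linkedU1 c d a b : diamond c d a b -> linked (c |: ~: [set c; d]).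
Proof.
move=> D; case: (D) => aNb d2 [ca ad] [cb bd].
apply: (linkedU1 (x := a) (diamond_linked D)); last by rewrite adj_sym.
rewrite !inE negb_or; apply/andP; split.
  by apply: contraTneq ca => ->; rewrite adj_irr.
by apply: contraTneq ad => ->; rewrite adj_irr.
Qed.

Lemma diamond_card c d a b : diamond c d a b ->
  #|~: [set c; d]| + 2 = #|G| /\ #|c |: ~: [set c; d]| + 1 = #|G|.
Proof.
case=> aNb d2 _ _; have cNd : c != d by rewrite -dist_gt0 // d2.
have := cardsC [set c; d]; rewrite cards2 cNd => <-; rewrite cardsU1.
have -> : c \notin ~: [set c; d] by rewrite !inE eqxx.
by move: #|~: _| => s /=; clear; lia.
Qed.

Lemma diamond_transmission c d a b t k : diamond c d a b -> #|G| = t.+3 -> 0 < k <= t ->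
  \sum_(y in ~: [set c; d]) dist c y + (#|cball (c |: ~: [set c; d]) c k| - k.+2)
     <= t.+1 + 'C(t, 2).
Proof.
move=> D cG kt; have [_ cU] := diamond_card D; case: (D) => aNb d2 [ca ad] [cb bd].
have mem x : adj c x -> adj x d -> x \in c |: ~: [set c; d].
  move=> cx xd; rewrite !inE negb_or; apply/orP; right; apply/andP; split.
    by apply: contraTneq cx => ->; rewrite adj_irr.
  by apply: contraTneq xd => ->; rewrite adj_irr.
have := transmission_le2 conG (diamond_linkedU1 D) (setU11 _ _) (mem a ca ad) (mem b cb bd) ca cb aNb _ kt.
rewrite big_setU1 ?inE ?eqxx //= distxx add0n; apply.
by apply/eqP; rewrite -(eqn_add2r 1) cU cG addn1.
Qed.

(* The Wiener index of [B1 t.+3], in the form in which the upper bound arises. *)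
Definition kite_wiener t := 'C(t.+2, 3) + 2 * (t.+1 + 'C(t, 2)) + 2.

Lemma diamond_wiener c d a b t : diamond c d a b -> #|G| = t.+3 ->
  2 * wiener G = dsum (~: [set c; d]) + 2 * \sum_(y in ~: [set c; d]) dist c y
     + 2 * \sum_(y in ~: [set c; d]) dist d y + 4.
Proof.
move=> D cG; case: (D) => aNb d2 _ _; have cNd : c != d by rewrite -dist_gt0 // d2.
have -> : 2 * wiener G = dsum (d |: (c |: ~: [set c; d])).
  by rewrite -dsumT //; congr dsum; apply/setP => x; rewrite !inE; case: eqP; case: eqP.
rewrite !dsumU1 // ?big_setU1 /= ?inE ?eqxx ?orbT //= ?[d == c]eq_sym ?(negPf cNd) //.
by rewrite (dist_sym conG d c) d2 mulnDr; lia.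
Qed.

Lemma diamond_dsum c d a b t : diamond c d a b -> #|G| = t.+3 ->
  dsum (~: [set c; d]) <= 2 * 'C(t.+2, 3).
Proof.
move=> D cG; have [cV _] := diamond_card D.
have cV' : #|~: [set c; d]| = t.+1.
  by apply/eqP; rewrite -(eqn_add2r 2) cV cG addn2.
by have := dsum_le conG (diamond_linked D); rewrite cV'.
Qed.

(** The surplus of one ball around [c] is kept in the bound: dropping it bounds the Wiener index,
    and it must vanish when that bound is attained. *)
Lemma diamond_wiener_layer c d a b t k : diamond c d a b -> #|G| = t.+3 -> 0 < k <= t ->
  wiener G + (#|cball (c |: ~: [set c; d]) c k| - k.+2) <= kite_wiener t.
Proof.
move=> D cG kt; have := diamond_wiener D cG; have := diamond_dsum D cG.
have := diamond_transmission D cG kt.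
have := diamond_transmission (diamond_swap_ends D) cG kt.
have -> : [set d; c] = [set c; d] by rewrite setUC.
rewrite /kite_wiener; move: (dsum _) (\sum_(y in _) dist c y) (\sum_(y in _) dist d y) => p q r.
move: #|cball (c |: _) c k| #|cball _ _ _| ('C(t.+2,3)) ('C(t,2)) => s1 s2 c1 c2.
lia.
Qed.

(** The lower bound is the growth of balls from [{c, a, b}] at radius 1; the upper bound is the
    vanishing of the surplus. *)
Lemma diamond_cball c d a b t k : diamond c d a b -> #|G| = t.+3 -> 0 < k <= t ->
  kite_wiener t <= wiener G -> #|cball (c |: ~: [set c; d]) c k| = k.+2.
Proof.
move=> D cG kt le; have := diamond_wiener_layer D cG kt.
have [_ cU] := diamond_card D; case: (D) => aNb d2 [ca ad] [cb bd].
have cU' : #|c |: ~: [set c; d]| = t.+2.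
  by apply/eqP; rewrite -(eqn_add2r 1) cU cG addn1.
have lS := diamond_linkedU1 D.
have cS : c \in c |: ~: [set c; d] by rewrite setU11.
have := @cball_grow G conG _ c k 1 3 lS cS; case/andP: kt => k0 kt /(_ k0).
have -> : 3 + (k - 1) = k.+2 by lia.
rewrite cU' => ge; suff /ge : minn 3 t.+2 <= #|cball (c |: ~: [set c; d]) c 1|.
  by move: #|cball _ _ _| => s; lia.
apply: leq_trans (geq_minl _ _) _.
have cNa : c != a by apply: contraTneq ca => ->; rewrite adj_irr.
have cNb : c != b by apply: contraTneq cb => ->; rewrite adj_irr.
have aNd : a != d by apply: contraTneq ad => ->; rewrite adj_irr.
have bNd : b != d by apply: contraTneq bd => ->; rewrite adj_irr.
have <- : #|[set c; a; b]| = 3.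
  by rewrite setUC cardsU1 !inE !negb_or eq_sym cNb eq_sym aNb cards2 cNa.
apply: subset_leq_card; apply/subsetP => y; rewrite !inE.
case/orP=> [/orP[]|] /eqP->; first by rewrite eqxx distxx.
  by rewrite (negPf aNd) orbF orbN (dist_adj conG ca).
by rewrite (negPf bNd) orbF orbN (dist_adj conG cb).
Qed.

End Diamond.

(** * The extremal graph *)

Section Kite.
Variable r : nat.

(* [B1 r.+4] with a plainer vertex type: [inl i] is the path, [inr 0] the other
   vertex of degree 3 of the diamond, [inr 1] and [inr 2] those of degree 2. *)
Definition kite_adj : rel ('I_r.+1 + 'I_3) := fun u v =>
  match u, v with
  | inl i, inl j => (i.+1 == j :> nat) || (j.+1 == i :> nat)
  | inl i, inr _ | inr _, inl i => i == 0 :> nat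
  | inr p, inr q => (p != q) && ((p == 0 :> nat) || (q == 0 :> nat))
  end.

Lemma kite_adj_sym : symmetric kite_adj.
Proof. by move=> [i|p] [j|q] //=; rewrite 1?eq_sym orbC. Qed.

Lemma kite_adj_irr : irreflexive kite_adj.
Proof. by move=> [i|p] /=; rewrite ?eqxx // orbb eqn_leq ltnn. Qed.

Definition kite : sgraph := SGraph kite_adj_sym kite_adj_irr.

End Kite.

Lemma isomorphic_sym (G H : sgraph) : isomorphic G H -> isomorphic H G.
Proof.
case=> f [[g fK gK] fadj]; exists g; split; first by exists f.
by move=> x y; rewrite -fadj !gK.
Qed.

Lemma isomorphic_trans (G H K : sgraph) :
  isomorphic G H -> isomorphic H K -> isomorphic G K.
Proof.
case=> f [bf fadj] [g [bg gadj]]; exists (g \o f); split; first exact: bij_comp.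
by move=> x y; rewrite /= gadj fadj.
Qed.

Lemma kite_B1 r : isomorphic (kite r) (B1 r.+4).
Proof.
have eqr : r.+1 = (r.+4 - 4).+1 by rewrite -addn4 addnK.
pose f (v : 'I_r.+1 + 'I_3) : B1 r.+4 := match v with
  | inl i => inl (cast_ord eqr i)
  | inr p => inr (exist (fun v => v != ord0) (lift ord0 p) isT)
  end.
exists f; split.
  apply: inj_card_bij.
    move=> [i|p] [j|q] //= []; first by move/val_inj->.
    by move/addnI/val_inj->.
  by apply: (leq_trans (eq_leq (@card_B1 r.+4 isT))); rewrite card_sum !card_ord addn3.
move=> [i|p] [j|q] //=; try by rewrite -val_eqE /= andbT.
by case: p q => [[|[|[|?]]] ?] [[|[|[|?]]] ?].
Qed.

(** * Shape of the graph in the case of equality *)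

Section KiteShape.
Variables (G : sgraph) (conG : connected G) (small : szeged G < wiener G + 3).
Implicit Types (c d a b x y z : G).

Lemma diamond_notin c d a b : diamond c d a b ->
  [/\ a != c, a != d, b != c & b != d] /\ c != d.
Proof.
case=> _ d2 [ca ad] [cb bd]; split; last by rewrite -dist_gt0 // d2.
by split; [apply: contraTneq ca => -> | apply: contraTneq ad => -> |
  apply: contraTneq cb => -> | apply: contraTneq bd => ->]; rewrite adj_irr.
Qed.

Lemma kite_dist_le c d a b r x : diamond c d a b -> #|G| = r.+4 ->
  kite_wiener r.+1 <= wiener G -> x \in ~: [set c; d] -> dist c x <= r.+1.
Proof.
move=> D cG ext xV; have cB := @diamond_cball G conG small c d a b r.+1 r.+1 D cG.
have [_ cU] := diamond_card conG D; set U := c |: ~: [set c; d] in cB cU *.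
have xU : x \in U by rewrite in_setU1 xV orbT.
have /eqP eU : cball U c r.+1 == U.
  rewrite eqEcard; apply/andP; split; first by apply/subsetP => z /[!inE]/andP[].
  by rewrite (cB (leqnn _) ext) -(leq_add2r 1) cU cG addn1.
by move: xU; rewrite -{1}eU inE => /andP[].
Qed.

(** Consecutive balls of positive radius differ by a single vertex, so the layers from the second on
    are singletons. *)
Lemma kite_dist_inj c d a b r x y : diamond c d a b -> #|G| = r.+4 ->
  kite_wiener r.+1 <= wiener G -> x \in ~: [set c; d] -> y \in ~: [set c; d] ->
  dist c x = dist c y -> 1 < dist c x -> x = y.
Proof.
move=> D cG ext xV yV dxy gt1.
have cB k := @diamond_cball G conG small c d a b r.+1 k D cG.
have [_ cU] := diamond_card conG D; set U := c |: ~: [set c; d] in cB cU *.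
have [xU yU] : x \in U /\ y \in U by rewrite !in_setU1 xV yV !orbT.
have le_r := kite_dist_le D cG ext xV.
have sB : cball U c (dist c x).-1 \subset cball U c (dist c x).
  by apply/subsetP => z /[!inE]/andP[-> /leq_trans]; apply; exact: leq_pred.
have k0 : 0 < (dist c x).-1 by case: (dist c x) gt1.
have c1 : #|cball U c (dist c x) :\: cball U c (dist c x).-1| <= 1.
  rewrite cardsD (setIidPr sB) !cB //; first by case: (dist c x) gt1 => // k _; rewrite /= subSnn.
    by rewrite k0 (leq_trans (leq_pred _)).
  by rewrite (ltnW gt1).
have gt_pred : (dist c x <= (dist c x).-1) = false by rewrite leqNgt prednK ?leqnn // ltnW.
by apply: (card_le1_eqP c1); rewrite in_setD ![_ \in cball _ _ _]in_set ?xU ?yU -?dxy gt_pred leqnn.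
Qed.

Lemma kite_end_nbr c d a b r x : diamond c d a b -> #|G| = r.+4 ->
  kite_wiener r.+1 <= wiener G -> adj c x -> (x == a) || (x == b).
Proof.
move=> D cG ext cx; have cB := @diamond_cball G conG small c d a b r.+1 1 D cG isT ext.
have [[aNc aNd bNc bNd] cNd] := diamond_notin D; case: (D) => aNb d2 [ca ad] [cb bd].
have /eqP eB : [set c; a; b] == cball (c |: ~: [set c; d]) c 1.
  rewrite eqEcard cB; apply/andP; split; last first.
    by rewrite setUC cardsU1 !inE !negb_or bNc eq_sym aNb cards2 eq_sym aNc.
  apply/subsetP => y; rewrite !inE -orbA => /or3P[]/eqP->.
  - by rewrite eqxx distxx.
  - by rewrite negb_or aNc aNd orbT (dist_adj conG ca).
  - by rewrite negb_or bNc bNd orbT (dist_adj conG cb).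
have xNc : x != c by apply: contraTneq cx => ->; rewrite adj_irr.
have xNd : x != d by apply: contraTneq cx => ->; apply/negP => /(dist_adj conG); rewrite d2.
have : x \in [set c; a; b] by rewrite eB !inE negb_or xNc xNd orbT (dist_adj conG cx).
by rewrite !inE (negPf xNc).
Qed.

(** By the last hypothesis the path leaves the diamond at [a]. The vertices other than [b], [c], [d]
    then have distinct distances from [c] and form that path. *)
Lemma kite_shape c d a b r : diamond c d a b -> #|G| = r.+4 ->
  kite_wiener r.+1 <= wiener G ->
  (forall x, x != d -> dist c x = 2 -> ~~ adj b x) -> isomorphic G (kite r).
Proof.
move=> D cG ext bN2.
have [[aNc aNd bNc bNd] cNd] := diamond_notin D; case: (D) => aNb d2 [ca ad] [cb bd].
have ab := diamond_chord conG small D.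
have Dr := diamond_swap_ends conG D.
pose P := ~: [set b; c; d].
have PV x : x \in P -> x \in ~: [set c; d].
  by rewrite !inE !negb_or -andbA => /and3P[_ -> ->].
have P_gt0 x : x \in P -> 0 < dist c x.
  by rewrite !inE !negb_or -andbA => /and3P[_ xNc _]; rewrite dist_gt0 // eq_sym.
have aP : a \in P by rewrite !inE !negb_or aNb aNc.
have da := dist_adj conG ca; have db := dist_adj conG cb.
have cP x : x \in P -> adj c x = (x == a).
  move=> xP; apply/idP/eqP => [cx|->//].
  have := kite_end_nbr D cG ext cx; move: xP; rewrite !inE !negb_or -andbA.
  by case/and3P=> /negPf-> _ _; rewrite orbF => /eqP.
have dP x : x \in P -> adj d x = (x == a).
  move=> xP; apply/idP/eqP => [dx|->]; last by rewrite adj_sym.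
  have := kite_end_nbr Dr cG ext dx; move: xP; rewrite !inE !negb_or -andbA.
  by case/and3P=> /negPf-> _ _; rewrite orbF => /eqP.
have P1 x : x \in P -> (dist c x == 1) = (x == a).
  move=> xP; rewrite -cP //; apply/eqP/idP => [|/(dist_adj conG)//].
  exact: adj_dist1.
have bP x : x \in P -> adj b x = (x == a).
  move=> xP; apply/idP/eqP => [bx|->]; last by rewrite adj_sym.
  apply/eqP; rewrite -P1 // eqn_leq P_gt0 // andbT leqNgt; apply/negP => gt1.
  have := dist_adjS conG c bx; rewrite db => le2.
  have xNd : x != d by move: xP; rewrite !inE !negb_or => /andP[].
  by have := bN2 x xNd; rewrite bx => /(_ (anti_leq (introT andP (conj le2 gt1)))).
have inj x y : x \in P -> y \in P -> dist c x = dist c y -> x = y.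
  move=> xP yP dxy; have [gt1|] := ltnP 1 (dist c x).
    exact: (kite_dist_inj D cG ext (PV x xP) (PV y yP) dxy gt1).
  move=> le1; have d1 : dist c x = 1 by apply/eqP; rewrite eqn_leq le1 P_gt0.
  move: (d1) => /eqP; rewrite P1 // => /eqP->.
  by move: d1; rewrite dxy => /eqP; rewrite P1 // => /eqP->.
(* The predecessor of [y] on a geodesic from [c] is none of [b], [c], [d], whose only neighbour in
   [P] is [a]; so it lies in [P], and it is [x] by injectivity of the distance. *)
have step x y : x \in P -> y \in P -> dist c y = (dist c x).+1 -> adj x y.
  move=> xP yP dy; have cNy : c != y by rewrite -dist_gt0 // dy.
  have yNa : y != a by rewrite -P1 // dy eqSS -lt0n P_gt0.
  have [z zy] := dist_pred conG cNy; rewrite dy => -[dz].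
  suff zP : z \in P by rewrite (inj x z).
  rewrite !inE !negb_or -andbA; apply/and3P; split; apply: contraTneq zy => zE.
  - by rewrite zE bP.
  - by move: (P_gt0 x xP); rewrite dz zE distxx.
  - by rewrite zE dP.
have le_r x : x \in P -> (dist c x).-1 < r.+1.
  by move=> xP; rewrite prednK ?P_gt0 // (kite_dist_le D cG ext) // PV.
(* The index on the path is the distance from [c] less one, since [a], at distance 1, is the end 0
   of the path. *)
pose f x : kite r := if x == b then inr (inord 0) else if x == c then inr (inord 1)
  else if x == d then inr (inord 2) else inl (inord (dist c x).-1).
have fb : f b = inr (inord 0) by rewrite /f eqxx.
have fc : f c = inr (inord 1) by rewrite /f eq_sym (negPf bNc) eqxx.
have fd : f d = inr (inord 2).
  by rewrite /f eq_sym (negPf bNd) eq_sym (negPf cNd) eqxx.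
have fP x : x \in P -> f x = inl (inord (dist c x).-1).
  rewrite !inE !negb_or -andbA /f => /and3P[].
  by case: eqP => // _; case: eqP => // _; case: eqP.
have cover x : [\/ x = b, x = c, x = d | x \in P].
  rewrite /P !inE; case: eqP => [->|_]; first by constructor 1.
  case: eqP => [->|_]; first by constructor 2.
  by case: eqP => [->|_]; [constructor 3 | constructor 4].
have fP0 x : x \in P -> ((inord (dist c x).-1 : 'I_r.+1) == 0 :> nat) = (x == a).
  move=> xP; rewrite inordK ?le_r // -P1 //.
  by move: (P_gt0 x xP); case: (dist c x).
have nat3 i : i < 3 -> (inord i : 'I_3) = i :> nat by move=> lt; rewrite inordK.
exists f; split.
  apply: inj_card_bij; last by rewrite card_sum !card_ord cG addn3.
  pose code (v : kite r) : nat := if v is inr p then val p else 0.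
  move=> x y; case: (cover x) => [->|->|->|xP]; case: (cover y) => [->|->|->|yP] //;
    rewrite ?fb ?fc ?fd ?fP //; try by move/(congr1 code); rewrite /= !nat3.
  case=> /(congr1 val); rewrite /= !inordK ?le_r // => eq_pred.
  by apply: inj => //; rewrite -[LHS]prednK ?P_gt0 // eq_pred prednK ?P_gt0.
have ba : adj b a by rewrite adj_sym.
have bc : adj b c by rewrite adj_sym.
have ncd : adj c d = false by apply/negP => /(dist_adj conG); rewrite d2.
have ndc : adj d c = false by rewrite adj_sym.
have dc : adj d b by rewrite adj_sym.
move=> x y; case: (cover x) => [->|->|->|xP]; case: (cover y) => [->|->|->|yP];
  rewrite ?fb ?fc ?fd ?fP //= -?val_eqE /= ?nat3 //= ?adj_irr ?fP0 //;
  rewrite ?bP ?cP ?dP // 1?[adj x _]adj_sym ?bP ?cP ?dP //.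
have px := prednK (P_gt0 x xP); have py := prednK (P_gt0 y yP).
rewrite !inordK ?le_r // px py [adj y x]adj_sym; apply/idP/idP.
  have gtx := P_gt0 x xP; have gty := P_gt0 y yP.
  case/orP=> /eqP E; last rewrite adj_sym.
    by apply: step => //; rewrite E py.
  by apply: step => //; rewrite E px.
move=> xy; have yx : adj y x by rewrite adj_sym.
have := dist_adjS conG c xy; have := dist_adjS conG c yx.
have := P_gt0 x xP; have := P_gt0 y yP.
have : dist c x != dist c y.
  by apply: contraTneq xy => /(inj x y xP yP)->; rewrite adj_irr.
by move: (dist c x) (dist c y) => p q; clear; lia.
Qed.

(** [a] and [b] cannot both have a neighbour other than [d] at distance 2 from [c]: that layer has
    one vertex [x], and [{c, x}] would have excess. So one of them plays the part of [b] in
    [kite_shape]. *)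
Lemma diamond_extremal c d a b r : diamond c d a b -> #|G| = r.+4 ->
  kite_wiener r.+1 <= wiener G -> isomorphic G (kite r).
Proof.
move=> D cG ext; have [[aNc aNd bNc bNd] cNd] := diamond_notin D.
have [/existsP[x /and3P[xNd /eqP dx bx]]|none] :=
    boolP [exists x, [&& x != d, dist c x == 2 & adj b x]]; last first.
  apply: (kite_shape D cG ext) => x xNd dx; apply: contra none => bx.
  by apply/existsP; exists x; rewrite xNd dx eqxx.
apply: (kite_shape (diamond_swap_mid D) cG ext) => y yNd dy; apply/negP => ay.
case: (D) => aNb _ [ca _] [cb _].
have inV z : z != d -> dist c z = 2 -> z \in ~: [set c; d].
  by move=> zNd dz; rewrite !inE negb_or zNd andbT; apply: contra_eqN dz => /eqP->; rewrite distxx.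
have xy : x = y.
  by apply: (kite_dist_inj D cG ext (inV x xNd dx) (inV y yNd dy)); rewrite dx ?dy.
subst y; have := sep_two_preds conG ay bx aNb; move/(_ c).
rewrite dx (dist_adj conG ca) (dist_adj conG cb) => /(_ isT isT).
have cNx : c != x by rewrite -dist_gt0 // dx.
have := diamond_only_excess conG small D cNx; rewrite !xpair_eqE eqxx (negPf xNd) (negPf cNd) dx.
by move=> /(_ isT isT) le /leq_trans/(_ le).
Qed.

End KiteShape.

(** * Indices of the extremal graph *)

Definition kite_dist r (u v : kite r) : nat :=
  match (u : 'I_r.+1 + 'I_3), (v : 'I_r.+1 + 'I_3) with
  | inl i, inl j => (i - j) + (j - i)
  | inl i, inr _ | inr _, inl i => i.+1
  | inr p, inr q => if p == q then 0 else if (p == 0 :> nat) || (q == 0 :> nat) then 1 else 2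
  end.

Lemma kite_distP r :
  connected (kite r) /\ forall u v : kite r, dist u v = kite_dist u v.
Proof.
apply: dist_unique => [[i|p]|[i|p] [j|q] [k|s]|[i|p] [j|q]]; rewrite /kite_dist /=.
- by rewrite subnn.
- by rewrite eqxx.
- by clear; lia.
- by move/eqP; clear; lia.
- by move/eqP; clear; lia.
- by move=> _; clear; lia.
- by clear; lia.
- by move/eqP=> ->; case: ifP => // _; case: ifP.
- by move/eqP=> ->; case: ifP => // _; case: ifP.
- by case: p q s => [[|[|[|?]]] ?] [[|[|[|?]]] ?] [[|[|[|?]]] ?].
- rewrite -[_ == _]val_eqE /= => /eqP iNj; have [lt|le] := ltnP i j.
    have ltj : j.-1 < r.+1 by rewrite (leq_ltn_trans (leq_pred j)).
    exists (inl (inord j.-1)); rewrite /= inordK //.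
      by apply/orP; left; rewrite prednK // (leq_ltn_trans _ lt).
    by move: iNj lt; clear; lia.
  have ltj : j.+1 < r.+1 by move: (ltn_ord i) le iNj; clear; lia.
  exists (inl (inord j.+1)); rewrite /= inordK //; first by rewrite eqxx orbT.
  by move: iNj le; clear; lia.
- by exists (inl ord0); rewrite //= subn0 sub0n addn0.
- case: (posnP j) => [j0 _|j_gt0 _]; first by exists (inr p); rewrite /= ?j0 ?eqxx.
  have ltj : j.-1 < r.+1 by rewrite (leq_ltn_trans (leq_pred j)).
  exists (inl (inord j.-1)); rewrite /= inordK // prednK //.
  by rewrite eqxx.
move=> pNq; have {pNq} pNq : p != q by apply: contra pNq => /eqP->.
rewrite (negPf pNq); have [or0|] := boolP (_ || _).
  by exists (inr p); rewrite /= ?eqxx // pNq.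
rewrite negb_or => /andP[p0 q0]; exists (inr ord0); rewrite /= ?eqxx ?orbT ?andbT -?val_eqE //=.
  by rewrite eq_sym.
by case: ifP.
Qed.

Lemma big_kite r (F : kite r -> nat) :
  \sum_u F u = \sum_(i < r.+1) F (inl i)
    + (F (inr (inord 0)) + F (inr (inord 1)) + F (inr (inord 2))).
Proof.
rewrite big_sumType /=; congr (_ + _); rewrite !big_ord_recl big_ord0 /= addn0 addnA.
by congr (F (inr _) + F (inr _) + F (inr _)); apply: val_inj; rewrite /= inordK.
Qed.

Lemma big_kite2 r (F : kite r -> kite r -> nat) :
  let T u := \sum_(i < r.+1) F u (inl i)
    + (F u (inr (inord 0)) + F u (inr (inord 1)) + F u (inr (inord 2))) in
  \sum_u \sum_v F u v = \sum_(i < r.+1) \sum_(j < r.+1) F (inl i) (inl j)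
    + \sum_(i < r.+1) (F (inl i) (inr (inord 0)) + F (inl i) (inr (inord 1))
        + F (inl i) (inr (inord 2)))
    + (T (inr (inord 0)) + T (inr (inord 1)) + T (inr (inord 2))).
Proof.
rewrite /= big_kite !(big_kite (F (inr _))); congr (_ + _).
by rewrite -big_split; apply: eq_bigr => i _; rewrite big_kite.
Qed.

Lemma sum_absdiff m :
  \sum_(i < m) \sum_(j < m) ((i - j) + (j - i)) = 2 * 'C(m.+1, 3).
Proof.
elim: m => [|m IHm]; first by rewrite big_ord0.
rewrite big_ord_recr /=; under eq_bigr do rewrite big_ord_recr /=.
rewrite big_split /= IHm big_ord_recr /= subnn !addn0 [in RHS]binS mulnDr -addnA; congr (_ + _).
have sumB : \sum_(i < m) (m - i) = 'C(m.+1, 2).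
  rewrite -(sum_rev m.+1) big_ord_recr /= subnn addn0.
  by apply: eq_bigr => i _; rewrite subSS.
rewrite mul2n -addnn -{1}sumB -sumB; congr (_ + _); apply: eq_bigr => i _.
  by rewrite (eqP (ltnW (ltn_ord i))).
by rewrite (eqP (ltnW (ltn_ord i))) addn0.
Qed.

Lemma kite_wienerE r : wiener (kite r) = kite_wiener r.+1.
Proof.
have [conK dE] := kite_distP r; apply/eqP; rewrite -(eqn_pmul2l (isT : 0 < 2)).
rewrite -sum_dist //; under eq_bigr do under eq_bigr do rewrite dE.
rewrite big_kite2 /kite_dist /= -!val_eqE /= !inordK //= sum_absdiff !big_split /=.
have -> : \sum_(i < r.+1) i.+1 = 'C(r.+2, 2).
  by rewrite -bin2_sum big_mkord [RHS]big_ord_recl.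
rewrite /kite_wiener [in 'C(r.+3, 3)]binS ['C(r.+2, 2)]binS bin1.
by move: ('C(r.+2, 3)) ('C(r.+1, 2)) => x y; clear; lia.
Qed.

Lemma sum_ltn_ord n m : \sum_(k < n) (k < m) = minn m n.
Proof.
elim: n => [|n IHn]; first by rewrite big_ord0 minn0.
by rewrite big_ord_recr IHn /=; clear; lia.
Qed.

Lemma sum_gtn_ord n m : \sum_(k < n) (m < k) = n - m.+1.
Proof.
elim: n => [|n IHn]; first by rewrite big_ord0.
by rewrite big_ord_recr IHn /=; clear; lia.
Qed.

Lemma sum_path_adj m (h : nat -> nat -> nat) : (forall i j, h i j = h j i) ->
  \sum_(i < m.+1) \sum_(j < m.+1) ((i.+1 == j) || (j.+1 == i)) * h i j
    = 2 * \sum_(i < m) h i i.+1.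
Proof.
move=> hC; elim: m => [|m IHm]; first by rewrite !big_ord_recl !big_ord0.
rewrite big_ord_recr /=; under eq_bigr do rewrite big_ord_recr /=.
rewrite big_split /= IHm [X in _ = 2 * X]big_ord_recr /= mulnDr -addnA; congr (_ + _).
rewrite [X in _ + X]big_ord_recr /= gtn_eqF //= mul0n addn0.
have last k : k = m -> \sum_(i < m.+1) ((i.+1 == m.+1) || (m.+2 == i)) * h i m.+1 = h m m.+1.
  move=> _; rewrite big_ord_recr /= eqxx mul1n big1 // => i _.
  by rewrite eqSS ltn_eqF // gtn_eqF // ltnS ltnW // ltnS ltnW.
rewrite (last m) // mul2n -addnn; congr (_ + _); rewrite -(last m) //.
by apply: eq_bigr => i _; rewrite orbC hC.
Qed.

(** The three vertices off the path are all at distance [i.+1] from vertex [i], hence on the side of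
    the smaller index. *)
Lemma kite_ncloser_path r (i j : 'I_r.+1) :
  @ncloser (kite r) (inl i) (inl j) =
    \sum_(k < r.+1) ((k - i) + (i - k) < (k - j) + (j - k)) + 3 * (i < j).
Proof.
have [_ dE] := kite_distP r; rewrite ncloserE big_kite !dE /kite_dist !ltnS.
congr (_ + _); last by clear; lia.
by apply: eq_bigr => k _; rewrite !dE.
Qed.

(** The extra vertex for nonzero [p] is the other tip of the diamond, adjacent to the end of the
    path but not to [p]. *)
Lemma kite_ncloser_end r (p : 'I_3) :
  @ncloser (kite r) (inl ord0) (inr p) = r.+1 + (p != 0 :> nat) /\
  @ncloser (kite r) (inr p) (inl ord0) = 1.
Proof.
have [_ dE] := kite_distP r; split; rewrite ncloserE big_kite !dE /kite_dist.
  rewrite (eq_bigr (fun=> 1)) => [|k _]; last by rewrite !dE /kite_dist subn0 sub0n addn0 ltnSn.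
  rewrite sum1_card card_ord; congr (_ + _); rewrite -!val_eqE /= !inordK //.
  by case: p => [[|[|[|?]]] ?].
rewrite big1 => [|k _]; last by rewrite !dE /kite_dist subn0 sub0n addn0 ltnNge leqnSn.
by rewrite -!val_eqE /= !inordK //; case: p => [[|[|[|?]]] ?].
Qed.

Lemma kite_ncloser_diamond r (p q : 'I_3) : @adj (kite r) (inr p) (inr q) ->
  @ncloser (kite r) (inr p) (inr q) = (p == 0 :> nat).+1.
Proof.
have [_ dE] := kite_distP r; rewrite ncloserE big_kite !dE /kite_dist.
rewrite big1 => [|k _]; last by rewrite !dE /kite_dist ltnn.
rewrite -!val_eqE /= !inordK //.
by case: p q => [[|[|[|?]]] ?] [[|[|[|?]]] ?].
Qed.

Lemma sum_end_adj r (h : 'I_r.+1 -> nat) :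
  \sum_(i < r.+1) (i == 0 :> nat) * h i = h ord0.
Proof. by rewrite big_ord_recl mul1n big1 ?addn0 // => i _; rewrite mul0n. Qed.

(** The path edge between [i] and [i.+1] has [i + 4] vertices on the side of the diamond and [r - i]
    on the other. *)
Lemma sum_path_szeged r :
  \sum_(i < r) (i + 4) * (r - i) = 'C(r.+2, 3) + 3 * 'C(r.+1, 2).
Proof.
elim: r => [|r IHr]; first by rewrite big_ord0.
transitivity (\sum_(i < r.+1) ((i + 4) * (r - i) + (i + 4))).
  by apply: eq_bigr => i _; rewrite -mulnSr subSn // -ltnS.
rewrite big_split big_ord_recr /= subnn muln0 addn0 IHr big_split /=.
rewrite sum_nat_const card_ord -(big_mkord xpredT id) bin2_sum.
rewrite ['C(r.+3, 3)]binS ['C(r.+2, 2)]binS bin1.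
by move: ('C(r.+2, 3)) ('C(r.+1, 2)) => x y; clear; lia.
Qed.

(** Besides the path edges, the three edges from the path to the diamond contribute [r.+1], [r.+2],
    [r.+2], and the two remaining edges contribute 2 each. *)
Lemma kite_szegedE r : szeged (kite r) = kite_wiener r.+1 + 2.
Proof.
have [_ dE] := kite_distP r; apply/eqP; rewrite -(eqn_pmul2l (isT : 0 < 2)) -sum_ncloser.
pose nc i j := \sum_(k < r.+1) ((k - i) + (i - k) < (k - j) + (j - k)) + 3 * (i < j).
have path_part : \sum_(i < r.+1) \sum_(j < r.+1) @adj (kite r) (inl i) (inl j)
    * (@ncloser (kite r) (inl i) (inl j) * @ncloser (kite r) (inl j) (inl i))
    = 2 * ('C(r.+2, 3) + 3 * 'C(r.+1, 2)).
  transitivity (\sum_(i < r.+1) \sum_(j < r.+1)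
      ((i.+1 == j) || (j.+1 == i)) * (nc i j * nc j i)).
    by apply: eq_bigr => i _; apply: eq_bigr => j _; rewrite !kite_ncloser_path.
  rewrite (sum_path_adj _ (h := fun i j => nc i j * nc j i)) => [|i j]; last exact: mulnC.
  congr (2 * _); transitivity (\sum_(i < r) (i + 4) * (r - i)).
    apply: eq_bigr => i _; rewrite /nc ltnSn ltnNge leqnSn muln0 addn0; congr (_ * _).
      transitivity (\sum_(k < r.+1) (k < i.+1) + 3); last first.
        by rewrite sum_ltn_ord (minn_idPl _) ?addSnnS // ltnS ltnW.
      by congr (_ + _); apply: eq_bigr => k _; congr nat_of_bool; clear; lia.
    rewrite -[RHS]/(r.+1 - i.+1) -sum_gtn_ord.
    by apply: eq_bigr => k _; congr nat_of_bool; clear; lia.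
  exact: sum_path_szeged.
have endE p : \sum_(i < r.+1) @adj (kite r) (inl i) (inr p)
    * (@ncloser (kite r) (inl i) (inr p) * @ncloser (kite r) (inr p) (inl i))
    = r.+1 + (p != 0 :> nat).
  rewrite (sum_end_adj (fun i => @ncloser (kite r) (inl i) (inr p)
    * @ncloser (kite r) (inr p) (inl i))).
  by have [-> ->] := kite_ncloser_end r p; rewrite muln1.
have endE' p : \sum_(i < r.+1) @adj (kite r) (inr p) (inl i)
    * (@ncloser (kite r) (inr p) (inl i) * @ncloser (kite r) (inl i) (inr p))
    = r.+1 + (p != 0 :> nat).
  by rewrite -endE; apply: eq_bigr => i _; rewrite adj_sym [X in _ * X]mulnC.
have inrE p q : @adj (kite r) (inr p) (inr q)
      * (@ncloser (kite r) (inr p) (inr q) * @ncloser (kite r) (inr q) (inr p))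
    = @adj (kite r) (inr p) (inr q) * ((p == 0 :> nat).+1 * (q == 0 :> nat).+1).
  have [pq|//] := boolP (@adj (kite r) (inr p) (inr q)).
  by rewrite !kite_ncloser_diamond // adj_sym.
rewrite big_kite2 path_part !big_split /= !endE !endE' !inrE /= -!val_eqE /= !inordK //=.
rewrite /kite_wiener ['C(r.+3, 3)]binS ['C(r.+2, 2)]binS bin1.
by move: ('C(r.+2, 3)) ('C(r.+1, 2)) => x y; clear; lia.
Qed.

(** * Comparison of the indices and conclusion *)

Lemma isomorphic_indices (G H : sgraph) : connected H -> isomorphic G H ->
  wiener G = wiener H /\ szeged G = szeged H.
Proof.
move=> conH [f [bf fadj]]; have [conG fd] := isom_dist conH bf fadj.
split; apply/eqP; rewrite -(eqn_pmul2l (isT : 0 < 2)); apply/eqP.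
  rewrite -!sum_dist // [RHS](reindex f) /=; last exact: onW_bij.
  apply: eq_bigr => x _; rewrite [RHS](reindex f) /=; last exact: onW_bij.
  by apply: eq_bigr => y _; rewrite fd.
rewrite -!sum_ncloser [RHS](reindex f) /=; last exact: onW_bij.
apply: eq_bigr => u _; rewrite [RHS](reindex f) /=; last exact: onW_bij.
have fnc x y : ncloser (f x) (f y) = ncloser x y.
  rewrite !ncloserE [LHS](reindex f) /=; last exact: onW_bij.
  by apply: eq_bigr => z _; rewrite !fd.
by apply: eq_bigr => v _; rewrite fadj !fnc.
Qed.

Lemma bin2_mul n : 2 * 'C(n.+1, 2) = n.+1 * n.
Proof. by elim: n => [|n IHn] //; rewrite binS mulnDr IHn bin1; lia. Qed.

Lemma bin3_mul n : 6 * 'C(n.+2, 3) = n.+2 * n.+1 * n.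
Proof.
elim: n => [|n IHn] //; rewrite binS mulnDr IHn.
by have := bin2_mul n.+1; move: ('C(_, _)) => x; nia.
Qed.

(** With $n = r + 4$ the right-hand side is $n^3 - 19n + 54$, expanded so that no truncated
    subtraction occurs. *)
Lemma kite_wiener_mul r : 6 * kite_wiener r.+1 = r ^ 3 + 12 * r ^ 2 + 29 * r + 42.
Proof.
rewrite /kite_wiener; have := bin3_mul r.+1; have := bin2_mul r.
move: ('C(_, 3)) ('C(_, 2)) => x y; rewrite !expnS expn0; nia.
Qed.

Lemma wiener_gt0 (G : sgraph) : connected G -> 1 < #|G| -> 0 < wiener G.
Proof.
move=> conG /card_gt1P[x [y [_ _ xNy]]]; rewrite -(ltn_pmul2l (isT : 0 < 2)) -sum_dist // muln0.
by rewrite (bigD1 x) //= (bigD1 y) //= -addnA ltn_addr // dist_gt0.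
Qed.

(** This is the inequality with its equality case, cleared of denominators: the bound equals
    $(K+2)/K$. *)
Lemma szeged_wiener_kite (G : sgraph) (H : subgraph G) r :
  connected G -> #|G| = r.+4 -> block H -> ~ complete H ->
  let K := kite_wiener r.+1 in
  K.+2 * wiener G <= K * szeged G /\
  (K.+2 * wiener G = K * szeged G -> isomorphic G (kite r)).
Proof.
move=> conG cG blH ncH K; have W0 : 0 < wiener G by rewrite wiener_gt0 ?cG.
have [big|small] := leqP (wiener G + 3) (szeged G).
  (* This makes [K.+2 * wiener G] smaller than [K * (wiener G + 3)], so the inequality is strict and
     the equality case void. *)
  have : 2 * wiener G < 3 * K.
    have := wiener_le conG; rewrite cG; have := bin3_mul r.+3; have := kite_wiener_mul r.
    rewrite -/K; move: ('C(_, 3)) K => x k; rewrite !expnS expn0.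
    move: (wiener G) => w; clear; nia.
  have : K * (wiener G + 3) <= K * szeged G by rewrite leq_mul2l big orbT.
  by move: (wiener G) (szeged G) => w s; clear; nia.
have [|[c [d [a [b D]]]]] := noncomplete_block_dichotomy conG blH ncH.
  by rewrite leqNgt small.
have le := diamond_szeged conG D.
have leW : wiener G <= K.
  have := @diamond_wiener_layer G conG small c d a b r.+1 1 D cG isT; rewrite -/K.
  by apply: leq_trans; exact: leq_addr.
have szE : szeged G = wiener G + 2.
  by move: le small; move: (wiener G) (szeged G) => w s; clear; lia.
(* With excess exactly 2 the inequality says that [wiener G] is at most [K], and equality in one is
   equality in the other. *)
rewrite szE; split; first by move: leW; move: (wiener G) K => w k; clear; nia.
move=> eqW; apply: (diamond_extremal conG small D cG); rewrite -/K.
by move: eqW leW; move: (wiener G) K => w k; clear; nia.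
Qed.

Import Order.TTheory GRing.Theory Num.Theory.
Local Open Scope ring_scope.

Theorem theorem2p3 (G : sgraph) (n : nat)
  (card_G : #|G| = n) (n_ge5 : (5 <= n)%N) (G_conn : connected G)
  (G_block : exists H : subgraph G, block H /\ ~ complete H) :
  let ratio : rat := (szeged G)%:R / (wiener G)%:R in
  let bound : rat := 1 + 12%:R / (n%:R ^+ 3 - 19%:R * n%:R + 54%:R) in
  bound <= ratio /\ (ratio = bound <-> isomorphic G (B1 n)).
Proof.
have [H [blH ncH]] := G_block.
have [r nE] : exists r, n = r.+4.
  by exists (n - 4)%N; rewrite -addn4 subnK // ltnW.
rewrite {}nE in card_G n_ge5 * => ratio bound.
have [le eqW] := szeged_wiener_kite G_conn card_G blH ncH.
set K := kite_wiener r.+1 in le eqW.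
have K_gt0 : (0 < K)%N by rewrite /K /kite_wiener addn2.
have W_gt0 : (0 < wiener G)%N by rewrite wiener_gt0 ?card_G.
have KR : (0 : rat) < K%:R by rewrite ltr0n.
have WR : (0 : rat) < (wiener G)%:R by rewrite ltr0n.
(* The denominator of the bound is [6 * K], so the fraction added to 1 is [2 / K]. *)
have boundE : bound = K.+2%:R / K%:R.
  rewrite /bound; have -> : (r.+4%:R ^+ 3 - 19%:R * r.+4%:R + 54%:R : rat) = 6%:R * K%:R.
    rewrite -[RHS]natrM /K kite_wiener_mul; ring.
  by rewrite -[K.+2]addn2 natrD; field; rewrite lt0r_neq0.
have [conK _] := kite_distP r.
split.
  by rewrite boundE ler_pdivrMr // mulrAC ler_pdivlMr // -!natrM ler_nat [leqRHS]mulnC.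
split=> [eqR|iso].
  apply: isomorphic_trans (kite_B1 r); apply: eqW.
  apply/eqP; rewrite -(eqr_nat rat) !natrM; move/eqP: eqR.
  by rewrite boundE eqr_div ?lt0r_neq0 // => /eqP <-; rewrite mulrC.
have isoK := isomorphic_trans iso (isomorphic_sym (kite_B1 r)).
have [WE SE] := isomorphic_indices conK isoK.
by rewrite boundE /ratio WE SE kite_szegedE kite_wienerE addn2.
Qed.
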